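(* The optimization problem Grp (defined in the context) is NP-hard: given a worker set $\mathcal{U}$ with skills, wages and pairwise distances, and thresholds $Q_1,\dots,Q_m$ and $C$, it is NP-hard to find a single group $\mathcal{G}\subseteq\mathcal{U}$ that minimizes $\mathrm{DiaDist}(\mathcal{G})$ subject to $\sum_{u\in\mathcal{G}}u_{d_i}\ge Q_i$ for all $i\in\{1,\dots,m\}$ and $\sum_{u\in\mathcal{G}}w_u\le C$. Equivalently, the decision version, which asks, given additionally a number $X$, whether there is a feasible group of diameter at most $X$, is NP-hard.
   Context: An instance of Grp consists of the following data (all numbers rational). - A finite set of workers $\mathcal{U}=\{u_1,\dots,u_n\}$ and a set of $m$ skill domains $d_1,\dots,d_m$ ($m$ is part of the input). - For each worker $u$ and each domain $d_i$, a skill value $u_{d_i}\in[0,1]$; for each worker $u$, a wage $w_u\in[0,1]$. - For each pair of workers, a symmetric distance $\mathrm{dist}(u,v)\in[0,1]$, with $\mathrm{dist}(u,u)=0$. - Skill thresholds $Q_1,\dots,Q_m\ge0$ and a cost budget $C\ge0$. The diameter of a group is $\mathrm{DiaDist}(\mathcal{G})=\max_{u,v\in\mathcal{G}}\mathrm{dist}(u,v)$. *)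

(* Defs.v *)
From HB Require Import structures.
From mathcomp Require Import all_boot all_order all_algebra.

Set Implicit Arguments.
Unset Strict Implicit.
Unset Printing Implicit Defensive.

Import Order.TTheory GRing.Theory Num.Theory.

(* Multi-tape Turing machines. The input alphabet is bool; a machine adds a
   finite alphabet of its own, and None is the blank. *)

Definition symbol (work : finType) : finType := option (bool + work).

Inductive direction := ToLeft | ToRight | Stay.

Record machine := Machine {
  work : finType;
  state : finType;
  tapes_pred : nat; (* there are tapes_pred.+1 tapes, hence at least one *)
  start : state;
  halting : pred state;
  accepting : pred state; (* only consulted on halting states *)
  delta : state -> {ffun 'I_tapes_pred.+1 -> symbol work} ->
          state * ('I_tapes_pred.+1 -> symbol work * direction)
}.

(* A two-way infinite tape: the head scans the first symbol of tright, tleft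
   lists the symbols to the left of the head starting from the nearest one, and
   both sequences are implicitly followed by infinitely many blanks. *)
Record tape (work : finType) := Tape {
  tleft : seq (symbol work);
  tright : seq (symbol work)
}.

Definition tape_of (W : finType) (s : seq bool) : tape W :=
  Tape [::] [seq Some (inl b) | b <- s].

Definition read (W : finType) (t : tape W) : symbol W := head None (tright t).

Definition write (W : finType) (a : symbol W) (t : tape W) : tape W :=
  Tape (tleft t) (a :: behead (tright t)).

Definition shift (W : finType) (d : direction) (t : tape W) : tape W :=
  match d with
  | ToLeft => Tape (behead (tleft t)) (head None (tleft t) :: tright t)
  | ToRight => Tape (read t :: tleft t) (behead (tright t))
  | Stay => t
  end.

Fixpoint leading_bits (W : finType) (s : seq (symbol W)) : seq bool :=
  if s is Some (inl b) :: s' then b :: leading_bits s' else [::].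

Record config (M : machine) := Config {
  cstate : state M;
  ctapes : {ffun 'I_(tapes_pred M).+1 -> tape (work M)}
}.

(* The i-th input string is written on tape i, with the head on its first
   symbol. *)
Definition init (M : machine) (inputs : seq (seq bool)) : config M :=
  Config (start M) [ffun i => tape_of (work M) (nth [::] inputs (val i))].

Definition halted (M : machine) (c : config M) : bool := halting (cstate c).

Definition accepts (M : machine) (c : config M) : bool := accepting (cstate c).

(* The string of bits that starts under the head of tape 0. *)
Definition output (M : machine) (c : config M) : seq bool :=
  leading_bits (tright (ctapes c ord0)).

Definition step (M : machine) (c : config M) : config M :=
  if halted c then c else
  let: (q, act) := delta (cstate c) [ffun i => read (ctapes c i)] in
  Config q [ffun i => shift (act i).2 (write (act i).1 (ctapes c i))].

(* Oracle machines: in a state of the set ask, the string output c is submitted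
   to the oracle, whose answer replaces the whole content of tape 0, before the
   ordinary transition is taken. *)
Definition query (M : machine) (O : seq bool -> seq bool) (c : config M) :
    config M :=
  Config (cstate c)
    [ffun i => if i == ord0 then tape_of (work M) (O (output c))
               else ctapes c i].

Definition oracle_step (M : machine) (ask : pred (state M))
    (O : seq bool -> seq bool) (c : config M) : config M :=
  if halted c then c
  else step (if ask (cstate c) then query O c else c).

Definition poly_bound (c d n : nat) : nat := c * n ^ d + c.

Definition polytime_function (f : seq bool -> seq bool) : Prop :=
  exists (M : machine) (c d : nat), forall x : seq bool,
    let e := iter (poly_bound c d (size x)) (@step M) (init M [:: x]) in
    halted e /\ output e = f x.

Definition polytime_relation (V : seq bool -> seq bool -> bool) : Prop :=
  exists (M : machine) (c d : nat), forall x y : seq bool,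
    let e := iter (poly_bound c d (size x + size y)) (@step M)
                  (init M [:: x; y]) in
    halted e /\ accepts e = V x y.

Definition language := seq bool -> Prop.

Definition NP (L : language) : Prop :=
  exists2 V : seq bool -> seq bool -> bool, polytime_relation V &
  exists c d : nat, forall x : seq bool,
    L x <-> exists y : seq bool, size y <= poly_bound c d (size x) /\ V x y.

Definition poly_many_one (L L' : language) : Prop :=
  exists2 f : seq bool -> seq bool, polytime_function f &
  forall x : seq bool, L x <-> L' (f x).

Definition NP_hard (L : language) : Prop :=
  forall L' : language, NP L' -> poly_many_one L' L.

(* A search problem relates an instance to each of its solutions. *)
Definition search_problem := seq bool -> seq bool -> Prop.

Definition solves (O : seq bool -> seq bool) (S : search_problem) : Prop :=
  forall z : seq bool, (exists a, S z a) -> S z (O z).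

Definition poly_turing (L : language) (S : search_problem) : Prop :=
  exists (M : machine) (ask : pred (state M)) (c d : nat),
  forall O : seq bool -> seq bool, solves O S ->
  forall x : seq bool,
    let e := iter (poly_bound c d (size x)) (@oracle_step M ask O)
                  (init M [:: x]) in
    halted e /\ (accepts e <-> L x).

Definition NP_hard_search (S : search_problem) : Prop :=
  forall L : language, NP L -> poly_turing L S.

Local Open Scope ring_scope.

Record grp_data := GrpData {
  workers : nat;
  domains : nat;
  skill : 'I_workers -> 'I_domains -> rat;
  wage : 'I_workers -> rat;
  dist : 'I_workers -> 'I_workers -> rat;
  threshold : 'I_domains -> rat;
  budget : rat
}.

(* The distance is not required to satisfy the triangle inequality. *)
Definition grp_instance (I : grp_data) : Prop :=
  [/\ forall (u : 'I_(workers I)) (i : 'I_(domains I)), 0 <= skill u i <= 1,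
      forall u : 'I_(workers I), 0 <= wage u <= 1,
      [/\ forall u v : 'I_(workers I), 0 <= dist u v <= 1,
          forall u v : 'I_(workers I), dist u v = dist v u
        & forall u : 'I_(workers I), dist u u = 0],
      forall i : 'I_(domains I), 0 <= threshold i
    & 0 <= budget I].

(* Distances are nonnegative, so the default value 0 of the maximum only
   matters for the empty group, which gets diameter 0. *)
Definition diameter (I : grp_data) (G : {set 'I_(workers I)}) : rat :=
  \big[Num.max/0]_(u in G) \big[Num.max/0]_(v in G) dist u v.

Definition feasible (I : grp_data) (G : {set 'I_(workers I)}) : Prop :=
  (forall i : 'I_(domains I), threshold i <= \sum_(u in G) skill u i) /\
  \sum_(u in G) wage u <= budget I.

(* Binary digits, least significant first; 0 has the single digit 0. *)
Definition binary (n : nat) : seq bool :=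
  [seq odd (n %/ 2 ^ i)%N | i <- iota 0 (trunc_log 2 n).+1].

(* Self-delimiting encodings: every item of a list is preceded by the bit true,
   and the list is closed by the bit false. *)
Definition enc_seq (T : Type) (enc : T -> seq bool) (s : seq T) : seq bool :=
  flatten [seq true :: enc x | x <- s] ++ [:: false].

Definition enc_fun (n : nat) (T : Type) (enc : T -> seq bool)
    (f : 'I_n -> T) : seq bool :=
  enc_seq enc [seq f i | i <- enum 'I_n].

Definition enc_nat (n : nat) : seq bool :=
  enc_seq (fun b : bool => [:: b]) (binary n).

(* Sign, absolute value of the numerator, denominator, in lowest terms. *)
Definition enc_rat (r : rat) : seq bool :=
  (r < 0) :: enc_nat `|numq r|%N ++ enc_nat `|denq r|%N.

Definition enc_grp (I : grp_data) : seq bool :=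
  enc_fun (fun u => enc_fun enc_rat (@skill I u)) id ++
  enc_fun enc_rat (@wage I) ++
  enc_fun (fun u => enc_fun enc_rat (@dist I u)) id ++
  enc_fun enc_rat (@threshold I) ++
  enc_rat (budget I).

Definition Grp_decision : language := fun z =>
  exists (I : grp_data) (X : rat),
    [/\ grp_instance I, z = enc_grp I ++ enc_rat X
      & exists G : {set 'I_(workers I)}, feasible G /\ diameter G <= X].

Definition optimal (I : grp_data) (G : {set 'I_(workers I)}) : Prop :=
  feasible G /\
  forall H : {set 'I_(workers I)}, feasible H -> diameter G <= diameter H.

(* The answer is the bit true followed by the characteristic vector of an
   optimal group, or the single bit false when no group is feasible. *)
Definition Grp_optimization : search_problem := fun z a =>
  exists I : grp_data,
    [/\ grp_instance I, z = enc_grp I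
      & (exists2 G : {set 'I_(workers I)}, optimal G &
           a = true :: [seq u \in G | u <- enum 'I_(workers I)]) \/
        ((forall G : {set 'I_(workers I)}, ~ feasible G) /\ a = [:: false])].

(* Main.v *)
(* Cook and Levin's argument aimed directly at Grp, with all distances 0, so that
   only feasibility matters. For a verifier M and an input x take m larger than
   the running time and an m by m tableau whose row t describes the configuration
   after t steps; the cells are listed row by row, and each must be coloured by a
   letter of a finite alphabet so that every 2 by 2 window is legal. The workers
   are the pairs (cell, colour). A domain with threshold 1 requires a worker in
   the cell, and one domain for each illegal window requires a worker that
   disagrees with it. The workers of the cell number j have wage 2^-(j+1) and the
   budget is 1 - 2^-N, N being the number of cells, so a feasible group has exactly
   one worker in every cell, hence is a legal colouring.

   The skill of a worker in a domain depends only on the offset between their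
   cells, on the label of the worker's cell and on finite data, so the encoding is
   written by nested loops along unary tapes, one of which carries the offsets and
   another the labels. *)

Require Import Defs.
From mathcomp Require Import all_boot all_order all_algebra.
From mathcomp Require Import zify ring lra.
From Stdlib Require Import FunctionalExtensionality Classical.

Set Implicit Arguments.
Unset Strict Implicit.
Unset Printing Implicit Defensive.

Import Order.TTheory GRing.Theory Num.Theory.

(** * Structured programs *)

(** The powers of two among the wages come from the binary encoding. With equal wages the budget
    would be the number of cells up to a factor, which the machine would have to convert to binary.
    Here every numerator and denominator is [2 ^ k] or [2 ^ k - 1], whose digits are runs of equal
    bits (but for one leading bit), and a loop along a unary tape prints them.

    With several tapes the scanned symbols lie at unrelated places, so no window of bounded size
    contains them all. Centring each tape at its head brings them together in column 0; a head move
    becomes a shift of the two half-tapes, which is again local.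

    Both conclusions use the same instance. All groups have diameter 0, so the decision problem is
    asked with [X = 0], while the search problem needs a single query: the first bit of any correct
    answer tells whether a feasible group exists. *)

Section Programs.

Variables (n : nat) (W : finType).

Let sym := symbol W.
Let tapes := {ffun 'I_n.+1 -> tape W}.
Let reads := {ffun 'I_n.+1 -> sym}.
Let action := 'I_n.+1 -> sym * direction.

Inductive prog :=
| Act of (reads -> action)
| Seq of prog & prog
| While of (reads -> bool) & prog.

Fixpoint pstate (p : prog) : finType :=
  match p with
  | Act _ => unit
  | Seq p1 p2 => (pstate p1 + pstate p2)%type
  | While _ p1 => option (pstate p1)
  end.

Fixpoint entry (p : prog) : pstate p :=
  match p with
  | Act _ => tt
  | Seq p1 p2 => inl (entry p1)
  | While _ p1 => None
  end.

Definition idle (r : reads) : action := fun i => (r i, Stay).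

(* The successor state None means that control leaves the program. *)
Fixpoint pdelta (p : prog) : pstate p -> reads -> option (pstate p) * action :=
  match p with
  | Act g => fun _ r => (None, g r)
  | Seq p1 p2 => fun s r =>
      match s with
      | inl s1 => let: (o, a) := pdelta s1 r in
          (Some (if o is Some s1' then inl s1' else inr (entry p2)), a)
      | inr s2 => let: (o, a) := pdelta s2 r in (omap inr o, a)
      end
  | While b p1 => fun s r =>
      match s with
      | None => (if b r then Some (Some (entry p1)) else None, idle r)
      | Some s1 => let: (o, a) := pdelta s1 r in (Some o, a)
      end
  end.

Definition act_on (a : action) (t : tapes) : tapes :=
  [ffun i => shift (a i).2 (write (a i).1 (t i))].

Definition reads_of (t : tapes) : reads := [ffun i => read (t i)].

Fixpoint exits (p : prog) (k : nat) (s : pstate p) (t t' : tapes) : Prop :=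
  if k is k'.+1 then
    let: (o, a) := pdelta s (reads_of t) in
    if o is Some s' then exits k' s' (act_on a t) t' else k' = 0 /\ t' = act_on a t
  else False.

Lemma exits_seq2 (p1 p2 : prog) k (s : pstate p2) t t' :
  exits k s t t' -> @exits (Seq p1 p2) k (inr s) t t'.
Proof.
elim: k s t => [//|k IHk] s t /=.
by case: pdelta => -[s'|] a //=; exact: IHk.
Qed.

Lemma exits_seq (p1 p2 : prog) k l (s : pstate p1) t t1 t' :
  exits k s t t1 -> exits l (entry p2) t1 t' ->
  @exits (Seq p1 p2) (k + l) (inl s) t t'.
Proof.
move=> + H2; elim: k s t => [//|k IHk] s t /=.
case: pdelta => -[s'|] a /=; first exact: IHk.
by case=> -> <-; apply: exits_seq2.
Qed.

Lemma exits_while_body b (p : prog) k l (s : pstate p) t t1 t' :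
  exits k s t t1 -> @exits (While b p) l None t1 t' ->
  @exits (While b p) (k + l) (Some s) t t'.
Proof.
move=> + H2; elim: k s t => [//|k IHk] s t /=.
case: pdelta => -[s'|] a /=; first exact: IHk.
by case=> -> <-.
Qed.

Local Open Scope ring_scope.

Definition offset (d : direction) : int :=
  match d with ToLeft => -1 | ToRight => 1 | Stay => 0 end.

(* In absolute coordinates: f is the contents of t and k the place of its head. *)
Definition shows (t : tape W) (f : int -> sym) (k : int) : Prop :=
  forall p : nat, nth None (tright t) p = f (k + p%:Z) /\
                  nth None (tleft t) p = f (k - 1 - p%:Z).

Definition fset (f : int -> sym) (k : int) (a : sym) : int -> sym :=
  fun z => if z == k then a else f z.

Lemma shows_read t f k : shows t f k -> read t = f k.
Proof. by move=> /(_ 0%N) [+ _]; rewrite /read addr0 -nth0. Qed.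

Lemma shows_apply t f k a d : shows t f k ->
  shows (shift d (write a t)) (fset f k a) (k + offset d).
Proof.
move=> H p; case: t H => l r H.
have Hl q : nth None l q = f (k - 1 - q%:Z) by case: (H q).
have Hr q : nth None r q = f (k + q%:Z) by case: (H q).
case: d; rewrite /= /fset.
- split; last first.
    by rewrite nth_behead Hl ifN; [congr f; lia | lia].
  case: p => [|[|p]] /=.
  + by rewrite -nth0 Hl ifN; [congr f; lia | lia].
  + by rewrite ifT //; lia.
  + by rewrite nth_behead Hr ifN; [congr f; lia | lia].
- split; first by rewrite nth_behead Hr ifN; [congr f; lia | lia].
  case: p => [|p] /=.
  + by rewrite ifT //; lia.
  + by rewrite Hl ifN; [congr f; lia | lia].
- split; last by rewrite Hl ifN; [congr f; lia | lia].
  case: p => [|p] /=.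
  + by rewrite ifT //; lia.
  + by rewrite nth_behead Hr ifN; [congr f; lia | lia].
Qed.

Definition all_show (t : tapes) (F : 'I_n.+1 -> int -> sym) (v : 'I_n.+1 -> int) :=
  forall i, shows (t i) (F i) (v i).

Definition scan (F : 'I_n.+1 -> int -> sym) (v : 'I_n.+1 -> int) : reads :=
  [ffun i => F i (v i)].

Lemma all_show_reads t F v : all_show t F v -> reads_of t = scan F v.
Proof. by move=> H; apply/ffunP => i; rewrite !ffunE (shows_read (H i)). Qed.

Lemma all_show_eq t F v F' v' : all_show t F v -> F =2 F' -> v =1 v' -> all_show t F' v'.
Proof. by move=> H eF ev i p; rewrite -!ev -!eF; apply: H. Qed.

(** A tape is not determined by its contents, since its two lists may end in any number of blanks.
    So the run starts from any [t] showing [F], and its end only has to show [F']. *)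
Definition computes (p : prog) F v F' v' (k : nat) : Prop :=
  forall t, all_show t F v -> exists2 t', all_show t' F' v' &
    exists2 k', (k' <= k)%N & exits k' (entry p) t t'.

Lemma computes_act g F v F' v' k :
  (forall i, fset (F i) (v i) (g (scan F v) i).1 =1 F' i) ->
  (forall i, v i + offset (g (scan F v) i).2 = v' i) -> (0 < k)%N ->
  computes (Act g) F v F' v' k.
Proof.
move=> eF ev k_gt0 t Ht; exists (act_on (g (reads_of t)) t); last by exists 1%N.
have H : all_show (act_on (g (reads_of t)) t)
    (fun i => fset (F i) (v i) (g (scan F v) i).1)
    (fun i => v i + offset (g (scan F v) i).2).
  by move=> i; rewrite ffunE (all_show_reads Ht); apply: shows_apply.
by apply: (all_show_eq H) => [i|]; [apply: eF | apply: ev].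
Qed.

Lemma computes_le p F v F' v' k l :
  computes p F v F' v' k -> (k <= l)%N -> computes p F v F' v' l.
Proof.
move=> H kl t /H [t' Ht' [k' k'k ex]]; exists t' => //; exists k' => //.
exact: leq_trans k'k kl.
Qed.

Lemma computes_eq p F v F1 v1 F' v' F1' v1' k :
  computes p F v F' v' k -> F1 =2 F -> v1 =1 v -> F' =2 F1' -> v' =1 v1' ->
  computes p F1 v1 F1' v1' k.
Proof.
move=> H eF ev eF' ev' t /all_show_eq /(_ eF ev) /H [t' Ht' ex].
by exists t' => //; apply: (all_show_eq Ht').
Qed.

Lemma computes_seq p1 p2 F v F1 v1 F' v' k l :
  computes p1 F v F1 v1 k -> computes p2 F1 v1 F' v' l ->
  computes (Seq p1 p2) F v F' v' (k + l).
Proof.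
move=> H1 H2 t /H1 [t1 /H2 [t' Ht' [l' ll ex2]] [k' kk ex1]].
exists t' => //; exists (k' + l')%N; first exact: leq_add.
exact: exits_seq ex1 ex2.
Qed.

(** The test of a [While] takes a step, which rewrites every scanned symbol. On an exhausted list
    this appends a blank: the record changes, but not what it shows. *)
Lemma all_show_idle t F v : all_show t F v -> all_show (act_on (idle (reads_of t)) t) F v.
Proof.
move=> Ht; apply: (@all_show_eq _ (fun i => fset (F i) (v i) (F i (v i)))
                    (fun i => v i + 0)) => [i|i z|i].
- rewrite ffunE /idle ffunE /= (shows_read (Ht i)).
  exact: (@shows_apply _ _ _ _ Stay).
- by rewrite /fset; case: eqP => [->|].
- by rewrite addr0.
Qed.

Lemma computes_while (b : reads -> bool) (p : prog) (F : nat -> 'I_n.+1 -> int -> sym)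
    (v : nat -> 'I_n.+1 -> int) (m k : nat) :
  (forall j, (j < m)%N -> b (scan (F j) (v j))) -> ~~ b (scan (F m) (v m)) ->
  (forall j, (j < m)%N -> computes p (F j) (v j) (F j.+1) (v j.+1) k) ->
  computes (While b p) (F 0%N) (v 0%N) (F m) (v m) (m * k.+1).+1.
Proof.
elim: m F v => [|m IHm] F v Hb nb Hp t Ht.
  exists (act_on (idle (reads_of t)) t); first exact: all_show_idle.
  by exists 1%N => //=; rewrite (all_show_reads Ht) (negPf nb).
have Ht0 := all_show_idle Ht.
have [t1 Ht1 [k1 k1k ex1]] := Hp 0%N isT _ Ht0.
have [||j jm|t' Ht' [l' ll ex2]] := IHm (fun j => F j.+1) (fun j => v j.+1) _ _ _ t1 Ht1.
- by move=> j jm; apply: Hb.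
- by [].
- exact: Hp.
exists t' => //; exists (k1 + l').+1; first by lia.
rewrite /= (all_show_reads Ht) Hb // -(all_show_reads Ht).
exact: exits_while_body ex1 ex2.
Qed.

End Programs.

(** * Emitters *)

Section Emitters.

Variables (n : nat) (W : finType).

Let sym := symbol W.
Let reads := {ffun 'I_n.+1 -> sym}.
Let I := 'I_n.+1.
Let letter := (bool + W)%type.

(* For i d P runs P once per letter of tape i, whose head sweeps that tape while
   every other tape j moves by d j per round; all heads then return. *)
Inductive emitter :=
| Emit of (reads -> option letter)
| Both of emitter & emitter
| For of I & (I -> direction) & emitter.

Local Open Scope ring_scope.

Definition word (s : seq letter) (z : int) : sym :=
  if z is Posz p then nth None [seq Some a | a <- s] p else None.

Lemma word_nil z : word [::] z = None.
Proof. by case: z => [[]|]. Qed.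

Lemma word_eqNone (s : seq letter) (z : int) :
  (word s z == None) = ~~ (0 <= z < (size s)%:Z).
Proof.
case: z => [p|//]; rewrite le0z_nat ltz_nat /=.
have [ps|ps] := ltnP p (size s); last by rewrite nth_default ?size_map.
case: s ps => [//|a s] ps.
by rewrite (nth_map a).
Qed.

Lemma word_rcons (s : seq letter) a :
  fset (word s) (size s) (Some a) =1 word (s ++ [:: a]).
Proof.
case=> [p|p] //; rewrite /fset /= eqz_nat map_cat nth_cat size_map.
case: ltngtP => // [ps|->]; last by rewrite subnn.
by rewrite !nth_default ?size_map //; [rewrite /=; lia | lia].
Qed.

Lemma fset_id (f : int -> sym) k : fset f k (f k) =1 f.
Proof. by move=> z; rewrite /fset; case: eqP => [->|]. Qed.

Definition advance (i : I) (d : I -> direction) (v : I -> int) (k : nat) : I -> int :=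
  fun j => if j == i then k%:Z else v j + k%:Z * offset (d j).

Section Output.

Variable o : I.

(** An emitter sees a blank on its output tape, because the head there stands just past the last
    letter written. *)
Definition look (s : I -> seq letter) (v : I -> int) : reads :=
  [ffun i => if i == o then None else word (s i) (v i)].

Fixpoint emitted (P : emitter) (s : I -> seq letter) (v : I -> int) : seq letter :=
  match P with
  | Emit g => if g (look s v) is Some a then [:: a] else [::]
  | Both P1 P2 => emitted P1 s v ++ emitted P2 s v
  | For i d P1 =>
      flatten [seq emitted P1 s (advance i d v k) | k <- iota 0 (size (s i))]
  end.

(* dirty is the set of the tapes whose head may be away from cell 0. *)
Fixpoint well_formed (dirty : pred I) (P : emitter) : bool :=
  match P with
  | Emit _ => true
  | Both P1 P2 => well_formed dirty P1 && well_formed dirty P2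
  | For i d P1 => [&& i != o, ~~ dirty i, offset (d o) == 0 &
      well_formed (fun j => [|| j == i, offset (d j) != 0 | dirty j]) P1]
  end.

Definition opposite (d : direction) : direction :=
  match d with ToLeft => ToRight | ToRight => ToLeft | Stay => Stay end.

Lemma offset_opposite d : offset (opposite d) = - offset d.
Proof. by case: d. Qed.

Definition move_heads (i : I) (e : direction) (d : I -> direction) : prog n W :=
  Act (fun r j => (r j, if j == i then e else d j)).

Definition nonblank (i : I) (r : reads) : bool := r i != None.

(** A [For] has no counter: on the way back it measures tape [i] again, undoing one move of the
    other heads per letter. The sweep ends one place past the word, and the return one place before
    it, whence the two single moves of head [i]. *)
Fixpoint compile (P : emitter) : prog n W :=
  match P with
  | Emit g => Act (fun r j =>
      if j == o then if g r is Some a then (Some a, ToRight) else (r j, Stay)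
      else (r j, Stay))
  | Both P1 P2 => Seq (compile P1) (compile P2)
  | For i d P1 =>
      Seq (While (nonblank i) (Seq (compile P1) (move_heads i ToRight d)))
     (Seq (move_heads i ToLeft (fun=> Stay))
     (Seq (While (nonblank i) (move_heads i ToLeft (opposite \o d)))
          (move_heads i ToRight (fun=> Stay))))
  end.

(** Each round of a [For] pays for a move and a loop test on the way out and the same on the way
    back, which makes 4. The final 4 covers the two failing tests and the two single moves. *)
Fixpoint cost (P : emitter) (m : nat) : nat :=
  match P with
  | Emit _ => 1
  | Both P1 P2 => (cost P1 m + cost P2 m)%N
  | For _ _ P1 => (m * (cost P1 m + 4) + 4)%N
  end.

Definition contents (s : I -> seq letter) (acc : seq letter) : I -> int -> sym :=
  fun i => word (if i == o then acc else s i).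

Definition positions (v : I -> int) (acc : seq letter) : I -> int :=
  fun i => if i == o then (size acc)%:Z else v i.

Lemma scan_look s v acc : scan (contents s acc) (positions v acc) = look s v.
Proof.
apply/ffunP => i; rewrite !ffunE /contents /positions; case: eqP => // _ /=.
by rewrite nth_default ?size_map.
Qed.

Lemma computes_move i e d s v v' acc k :
  (forall j, j != o -> v j + offset (if j == i then e else d j) = v' j) ->
  i != o -> offset (d o) = 0 -> (0 < k)%N ->
  computes (move_heads i e d) (contents s acc) (positions v acc)
                        (contents s acc) (positions v' acc) k.
Proof.
move=> Hv io d0 k0; apply: computes_act => [j|j|] //=.
  by rewrite ffunE; exact: fset_id.
rewrite /positions; case: (eqVneq j o) => [->|jo]; last exact: Hv.
by rewrite eq_sym (negPf io) d0 addr0.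
Qed.

Lemma nonblank_scan i s v acc : i != o ->
  nonblank i (scan (contents s acc) (positions v acc)) = (0 <= v i < (size (s i))%:Z).
Proof.
move=> io; rewrite scan_look /nonblank ffunE (negPf io).
by rewrite word_eqNone negbK.
Qed.

Lemma compile_computes P dirty s v acc m :
  well_formed dirty P -> (forall j, ~~ dirty j -> v j = 0) ->
  (forall j, j != o -> size (s j) <= m)%N ->
  computes (compile P) (contents s acc) (positions v acc)
    (contents s (acc ++ emitted P s v)) (positions v (acc ++ emitted P s v)) (cost P m).
Proof.
move=> + + sm; elim: P dirty v acc => [g|P1 IH1 P2 IH2|i d P IHP] dirty v acc /=.
- move=> _ _; apply: computes_act => // j; rewrite scan_look.
    rewrite /contents /positions; case: (eqVneq j o) => [->|jo]; last first.
      by rewrite /= ffunE (negPf jo); exact: fset_id.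
    case: (g _) => [a|] /=; first exact: word_rcons.
    rewrite cats0 ffunE eqxx => z; rewrite /fset; case: eqP => // -> /=.
    by rewrite nth_default ?size_map.
  rewrite /positions; case: eqP => [->|_]; last by rewrite /= addr0.
  by case: (g _) => [a|] /=; rewrite size_cat /= ?addn0 ?addr0 //; lia.
- case/andP=> w1 w2 Hv; rewrite catA.
  exact: computes_seq (IH1 _ _ _ w1 Hv) (IH2 _ _ _ w2 Hv).
- case/and4P=> io di /eqP d0 wP Hv.
  set l := size (s i); set w := advance i d v.
  pose A k := acc ++ flatten [seq emitted P s (w k) | k <- iota 0 k].
  have v0 : v i = 0 by apply: Hv.
  apply: (@computes_le _ _ _ _ _ _ _
    ((l * (cost P m + 1).+1).+1 + (1 + ((l * 2).+1 + 1)))%N); last first.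
    by have := sm _ io; rewrite -/l; nia.
  have A1 k : A k.+1 = A k ++ emitted P s (w k).
    by rewrite /A -addn1 iotaD map_cat flatten_cat /= cats0 catA.
  have w0 : w 0%N =1 v.
    by move=> j; rewrite /w /advance; case: eqP => [->|_]; [rewrite v0|rewrite mul0r addr0].
  have wi k : w k i = k%:Z by rewrite /w /advance eqxx.
  apply: computes_seq.
    apply: (@computes_eq _ _ _ (contents s (A 0%N)) (positions (w 0%N) (A 0%N))
       _ _ (contents s (A l)) (positions (w l) (A l))).
    + apply: (@computes_while _ _ _ _ (fun k => contents s (A k))
               (fun k => positions (w k) (A k))) => [k kl||k kl].
      * by rewrite nonblank_scan // wi; lia.
      * by rewrite nonblank_scan // wi; lia.
      * rewrite A1; apply: computes_seq (IHP _ _ _ wP _) _ => [j|].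
          rewrite !negb_or negbK => /and3P [ji /eqP dj0 jd].
          by rewrite /w /advance (negPf ji) dj0 mulr0 addr0 Hv.
        apply: computes_move => // j jo; rewrite /w /advance.
        by case: eqP => [_|_]; [rewrite /=; lia|case: (d j) => /=; lia].
    + by move=> j z; rewrite /contents /A /= cats0.
    + by move=> j; rewrite /positions /A /= cats0 w0.
    + by [].
    + by [].
  (* Positions on the way back: head [i] runs from its last letter, at [l - 1], to the blank at
     [-1], while the other heads undo their [l] moves. *)
  pose u k : I -> int := fun j => if j == i then (l%:Z - 1 - k%:Z) else
                              v j + (l%:Z - k%:Z) * offset (d j).
  apply: (@computes_seq _ _ _ _ _ _ (contents s (A l)) (positions (u 0%N) (A l))).
    apply: computes_move => // j jo; rewrite /w /u /advance.
    by case: eqP => _ /=; lia.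
  apply: (@computes_seq _ _ _ _ _ _ (contents s (A l)) (positions (u l) (A l))).
    apply: (@computes_while _ _ _ _ (fun=> contents s (A l))
               (fun k => positions (u k) (A l))) => [k kl||k kl].
    + by rewrite nonblank_scan // /u eqxx; lia.
    + by rewrite nonblank_scan // /u eqxx; lia.
    + apply: computes_move => //= [j jo|]; last by rewrite offset_opposite d0.
      by rewrite /u; case: eqP => _; [|rewrite /= offset_opposite; case: (d j)] => /=; lia.
  apply: computes_move => // j jo; rewrite /u.
  by case: eqP => [->|_] /=; rewrite ?v0; lia.
Qed.

(** A step writes at most one letter, so the cost also bounds the output, and with it the tapes that
    the next stage reads. *)
Lemma size_emitted P dirty s v m : (forall j, j != o -> size (s j) <= m)%N ->
  well_formed dirty P -> (size (emitted P s v) <= cost P m)%N.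
Proof.
move=> sm; elim: P dirty v => [g|P1 IH1 P2 IH2|i d P IHP] dirty v /=.
- by case: (g _).
- by case/andP=> w1 w2; rewrite size_cat leq_add ?(IH1 dirty) ?(IH2 dirty).
- case/and4P=> io _ _ wP; apply: leq_trans (leq_addr _ _).
  apply: (@leq_trans (size (s i) * cost P m)); last first.
    by apply: leq_mul; [exact: sm|exact: leq_addr].
  elim: (iota _ _) (size_iota 0 (size (s i))) => [|k r IHr] /=; first by move=> <-.
  move: (size (s i)) => l <-; rewrite size_cat mulSn leq_add ?(IHP _ _ wP) //.
  by elim: r {IHr} => //= k' r IHr; rewrite size_cat mulSn leq_add ?(IHP _ _ wP).
Qed.

Definition rewind : prog n W :=
  Seq (move_heads o ToLeft (fun=> Stay))
 (Seq (While (nonblank o) (move_heads o ToLeft (fun=> Stay)))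
      (move_heads o ToRight (fun=> Stay))).

Lemma rewind_computes s acc :
  computes rewind (contents s acc) (positions (fun=> 0) acc)
                  (contents s acc) (fun=> 0) ((size acc * 2).+1 + 2)%N.
Proof.
pose u k : I -> int := fun j => if j == o then (size acc)%:Z - 1 - k%:Z else 0.
have mv e v v' : (forall j, v j + (if j == o then offset e else 0) = v' j) ->
    computes (move_heads o e (fun=> Stay)) (contents s acc) v (contents s acc) v' 1.
  move=> Hv; apply: computes_act => // j; first by rewrite /= ffunE; exact: fset_id.
  by rewrite -Hv /=; case: eqP.
apply: (@computes_le _ _ _ _ _ _ _ (1 + ((size acc * 2).+1 + 1))%N); last by lia.
apply: (@computes_seq _ _ _ _ _ _ (contents s acc) (u 0%N)).
  by apply: mv => j; rewrite /positions /u; case: eqP => _; rewrite ?subr0 ?addr0.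
apply: (@computes_seq _ _ _ _ _ _ (contents s acc) (u (size acc))).
  have nb k : nonblank o (scan (contents s acc) (u k)) = (k < size acc)%N.
    by rewrite /nonblank ffunE /contents /u eqxx word_eqNone negbK; lia.
  apply: (@computes_while _ _ _ _ (fun=> contents s acc) u) => [k kl||k kl].
  - by rewrite nb.
  - by rewrite nb ltnn.
  - by apply: mv => j; rewrite /u; case: eqP => _ /=; lia.
by apply: mv => j; rewrite /u; case: eqP => _ /=; lia.
Qed.

Definition erase : prog n W :=
  While (nonblank o) (Act (fun r j => if j == o then (None, ToRight) else (r j, Stay))).

(** The head of [o] ends past the erased word, yet its final position is declared to be 0: a blank
    tape looks the same from every place, so its origin can be moved under the head and no walk back
    is needed. *)
Lemma erase_computes s :
  computes erase (fun i => word (s i)) (fun=> 0) (contents s [::]) (fun=> 0)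
    (size (s o) * 2).+1.
Proof.
pose F k : I -> int -> sym := fun j z =>
  if (j == o) && (z < k%:Z) then None else word (s j) z.
pose u k : I -> int := fun j => if j == o then k%:Z else 0.
have nb k : nonblank o (scan (F k) (u k)) = (k < size (s o))%N.
  by rewrite /nonblank ffunE /F /u eqxx andTb ltxx word_eqNone negbK; lia.
move=> t Ht; have Ht0 : all_show t (F 0%N) (u 0%N).
  apply: (all_show_eq Ht) => [j z|j]; last by rewrite /u; case: eqP.
  by rewrite /F; case: eqP => //= _; case: z.
have [||k kl|t' Ht' ex] := @computes_while _ _ (nonblank o)
  (Act (fun r j => if j == o then (None, ToRight) else (r j, Stay)))
  F u (size (s o)) 1 _ _ _ t Ht0.
- by move=> k kl; rewrite nb.
- by rewrite nb ltnn.
- apply: computes_act => // j.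
    rewrite ffunE /F /u; case: eqP => [->|_] z /=; last exact: fset_id.
    have -> : (z < k.+1%:Z) = (z == k%:Z) || (z < k%:Z) by lia.
    by rewrite /fset; case: eqP.
  by rewrite /u; case: eqP => _ /=; lia.
have gone z : (if z < (size (s o))%:Z then None else word (s o) z) = None.
  by case: ifP => // Hz; apply/eqP; rewrite word_eqNone; lia.
exists t' => // j p; rewrite /contents; have := Ht' j p.
by rewrite /F /u; case: eqP => [->|//]; rewrite andTb !gone !word_nil.
Qed.

Definition stage_prog (P : emitter) : prog n W :=
  Seq erase (Seq (compile P) rewind).

Definition stage_result (P : emitter) (s : I -> seq letter) : I -> seq letter :=
  fun i => if i == o then emitted P s (fun=> 0) else s i.

Lemma stage_computes P s m : well_formed (fun=> false) P ->
  (forall i, size (s i) <= m)%N ->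
  computes (stage_prog P) (fun i => word (s i)) (fun=> 0)
    (fun i => word (stage_result P s i)) (fun=> 0) (m * 2 + cost P m * 3 + 4)%N.
Proof.
move=> wP sm; have sm' j : j != o -> (size (s j) <= m)%N by [].
apply: (@computes_le _ _ _ _ _ _ _ ((size (s o) * 2).+1 +
   (cost P m + ((size (emitted P s (fun=> 0%R)) * 2).+1 + 2)))%N); last first.
  by have := size_emitted (fun=> 0) sm' wP; have := sm o; lia.
apply: computes_seq (@erase_computes s) _.
apply: computes_seq.
  apply: (computes_eq (@compile_computes _ _ _ (fun=> 0) [::] _ wP _ sm')) => //.
  by move=> j; rewrite /positions; case: eqP.
exact: rewind_computes.
Qed.

End Output.

Fixpoint pipe (q : seq (I * emitter)) : prog n W :=
  if q is (o, P) :: q' then Seq (stage_prog o P) (pipe q') else Act (@idle n W).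

Fixpoint pipe_result (q : seq (I * emitter)) (s : I -> seq letter) : I -> seq letter :=
  if q is (o, P) :: q' then pipe_result q' (stage_result o P s) else s.

Fixpoint pipe_cost (q : seq (I * emitter)) (m : nat) : nat :=
  if q is (o, P) :: q' then
    (m * 2 + cost P m * 3 + 4 + pipe_cost q' (m + cost P m))%N
  else 1%N.

Definition pipe_wf (q : seq (I * emitter)) : bool :=
  all (fun oP => well_formed oP.1 (fun=> false) oP.2) q.

Lemma pipe_computes q s m : pipe_wf q -> (forall i, size (s i) <= m)%N ->
  computes (pipe q) (fun i => word (s i)) (fun=> 0)
    (fun i => word (pipe_result q s i)) (fun=> 0) (pipe_cost q m).
Proof.
elim: q s m => [|[o P] q IHq] s m /=.
  move=> _ _; apply: computes_act => // i.
  by rewrite /= ffunE; exact: fset_id.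
case/andP=> wP wq sm; apply: computes_seq (stage_computes wP sm) _.
apply: IHq => // i; rewrite /stage_result; case: eqP => _.
  by apply: leq_trans (leq_addl _ _); apply: size_emitted wP.
exact: leq_trans (sm i) (leq_addr _ _).
Qed.

End Emitters.

(** * Polynomial bounds *)

Definition poly_bounded (g : nat -> nat) :=
  exists c d, forall m, g m <= c * m.+1 ^ d.

Lemma poly_bounded_const c : poly_bounded (fun=> c).
Proof. by exists c, 0 => m; rewrite expn0 muln1. Qed.

Lemma poly_bounded_id : poly_bounded id.
Proof. by exists 1, 1 => m; rewrite mul1n expn1. Qed.

Lemma poly_bounded_add f g :
  poly_bounded f -> poly_bounded g -> poly_bounded (fun m => f m + g m).
Proof.
case=> [c1 [d1 H1]] [c2 [d2 H2]]; exists (c1 + c2), (d1 + d2) => m.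
rewrite mulnDl; apply: leq_add.
  by apply: (leq_trans (H1 m)); rewrite leq_mul // leq_pexp2l ?leq_addr.
by apply: (leq_trans (H2 m)); rewrite leq_mul // leq_pexp2l ?leq_addl.
Qed.

Lemma poly_bounded_mul f g :
  poly_bounded f -> poly_bounded g -> poly_bounded (fun m => f m * g m).
Proof.
case=> [c1 [d1 H1]] [c2 [d2 H2]]; exists (c1 * c2), (d1 + d2) => m.
by rewrite expnD mulnACA leq_mul.
Qed.

Lemma poly_bounded_comp f g :
  poly_bounded f -> poly_bounded g -> poly_bounded (fun m => f (g m)).
Proof.
case=> [c1 [d1 H1]] [c2 [d2 H2]]; exists (c1 * c2.+1 ^ d1), (d2 * d1) => m.
apply: (leq_trans (H1 _)); rewrite -mulnA leq_mul // expnM -expnMn.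
have [->|d1_gt0] := posnP d1; first by rewrite !expn0.
rewrite leq_exp2r //; have := H2 m; have : 0 < m.+1 ^ d2 by rewrite expn_gt0.
by rewrite mulSn; lia.
Qed.

Lemma poly_bounded_poly_bound c d : poly_bounded (poly_bound c d).
Proof.
apply: poly_bounded_add; last exact: poly_bounded_const.
apply: poly_bounded_mul; first exact: poly_bounded_const.
by exists 1, d => m; rewrite mul1n; case: d => // d; rewrite leq_exp2r.
Qed.

(** The base [m.+1] of [poly_bounded] is never 0, so larger exponents give larger bounds, which the
    closure under sums relies on. For [m > 0] the inequality [m.+1 <= 2 * m] leads back to
    [poly_bound] at the price of a factor [2 ^ d]. *)
Lemma poly_boundedP g : poly_bounded g ->
  exists c d, forall m, g m <= poly_bound c d m.
Proof.
case=> [c [d H]]; exists (c * 2 ^ d), d => m; apply: (leq_trans (H m)).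
rewrite /poly_bound -mulnSr -mulnA leq_mul //.
case: m {H} => [|m]; first by rewrite exp1n muln_gt0 expn_gt0.
apply: (@leq_trans ((2 * m.+1) ^ d)); last by rewrite expnMn leq_mul.
by case: d => // d; rewrite leq_exp2r //; lia.
Qed.

Lemma poly_bounded_cost n W (P : emitter n W) : poly_bounded (cost P).
Proof.
elim: P => [g|P1 IH1 P2 IH2|i d P IHP] /=; first exact: poly_bounded_const.
  exact: poly_bounded_add.
apply: poly_bounded_add; last exact: poly_bounded_const.
apply: poly_bounded_mul; first exact: poly_bounded_id.
by apply: poly_bounded_add; last exact: poly_bounded_const.
Qed.

Lemma poly_bounded_pipe_cost n W (q : seq ('I_n.+1 * emitter n W)) :
  poly_bounded (pipe_cost q).
Proof.
elim: q => [|[o P] q IHq] /=; first exact: poly_bounded_const.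
apply: poly_bounded_add.
  apply: poly_bounded_add; last exact: poly_bounded_const.
  apply: poly_bounded_add; apply: poly_bounded_mul; try exact: poly_bounded_const.
    exact: poly_bounded_id.
  exact: poly_bounded_cost.
apply: (@poly_bounded_comp (pipe_cost q) (fun m => m + cost P m)) => //.
by apply: poly_bounded_add; [exact: poly_bounded_id|exact: poly_bounded_cost].
Qed.

(** * Machines running a pipe of emitters *)

Section Driver.

Variables (n : nat) (W : finType) (p : prog n W).

(* In state inr None the program is done; one more step moves to inr (Some b),
   where b tells whether tape 0 starts with the bit true. *)
Definition driver_state : finType := (pstate p + option bool)%type.

Definition driver (halt : pred driver_state) : machine :=
  @Machine W driver_state n (inl (entry p)) halt
    (fun s => if s is inr (Some b) then b else false)
    (fun s r => match s with
       | inl s1 => let: (o, a) := pdelta s1 r in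
           (if o is Some s' then inl s' else inr None, a)
       | inr _ => (inr (Some (r ord0 == Some (inl true))), idle r)
       end).

(** Any [next] that agrees with [step] while the program runs is allowed, so that the lemma serves
    both the plain and the oracle machine. *)
Lemma driver_exits halt (next : config (driver halt) -> config (driver halt)) k s t t' :
  (forall s1 t1, next (@Config (driver halt) (inl s1) t1) =
                 step (@Config (driver halt) (inl s1) t1)) ->
  (forall s1, ~~ halt (inl s1)) -> exits k s t t' ->
  iter k next (@Config (driver halt) (inl s) t) = @Config (driver halt) (inr None) t'.
Proof.
move=> Hnext Hhalt; elim: k s t => [//|k IHk] s t.
rewrite iterSr Hnext /step /halted /= (negPf (Hhalt s)).
rewrite -/(reads_of t); case: pdelta => -[s'|] a; first exact: IHk.
by case=> -> ->.
Qed.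

End Driver.

Section Pipes.

Variables (n : nat) (W : finType).

Definition input_words (x : seq bool) : 'I_n.+1 -> seq (bool + W) :=
  fun i => if i == ord0 then [seq inl b | b <- x] else [::].

Lemma init_shows (M : prog n W) (halt : pred (driver_state M)) (x : seq bool) :
  all_show (ctapes (@init (@driver n W M halt) [:: x])) (fun i => word (input_words x i))
           (fun=> 0%R).
Proof.
move=> i k; rewrite /init /= ffunE /tape_of /= nth_nil add0r; split=> //.
  rewrite /input_words -val_eqE /=; case: (val i) => [|j] /=; last by rewrite nth_nil nth_nil.
  by rewrite -map_comp.
by case: k.
Qed.

Lemma leading_bits_shows (t : tape W) z :
  shows t (word [seq inl b | b <- z]) 0%R -> leading_bits (tright t) = z.
Proof.
move=> H; have {}H k : nth None (tright t) k = nth None [seq Some (inl b) | b <- z] k.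
  by have [-> _] := H k; rewrite add0r /= -map_comp.
elim: z (tright t) H => [|b z IHz] [|a r] H //=.
- by have /= -> := H 0.
- by have := H 0.
- have /= -> := H 0; rewrite IHz // => k; exact: (H k.+1).
Qed.

Variables (q : seq ('I_n.+1 * emitter n W)) (f : seq bool -> seq bool).
Hypothesis q_wf : pipe_wf q.
Hypothesis q_out : forall x, pipe_result q (input_words x) ord0 = [seq inl b | b <- f x].

Lemma pipe_exits (halt : pred (driver_state (pipe q))) x :
  exists2 t' : {ffun 'I_n.+1 -> tape W}, leading_bits (tright (t' ord0)) = f x &
  exists2 k, k <= pipe_cost q (size x) &
    exits k (entry (pipe q)) (ctapes (@init (@driver n W (pipe q) halt) [:: x])) t'.
Proof.
have sz i : size (input_words x i) <= size x.
  by rewrite /input_words; case: eqP; rewrite ?size_map.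
have [t' Ht' ex] := pipe_computes q_wf sz (@init_shows (pipe q) halt x).
exists t' => //; apply: leading_bits_shows; rewrite -q_out; exact: Ht'.
Qed.

Lemma pipe_polytime : polytime_function f.
Proof.
have [c [d cd]] := poly_boundedP (poly_bounded_pipe_cost q).
pose halt (s : driver_state (pipe q)) := if s is inr _ then true else false.
exists (@driver n W (pipe q) halt), c, d => x; cbv zeta.
have [t' Ht' [k kle ex]] := pipe_exits halt x.
rewrite -(subnK (leq_trans kle (cd _))) iterD.
rewrite (@driver_exits n W (pipe q) halt (@step (@driver n W (pipe q) halt))
           k (entry (pipe q)) _ t') //.
by rewrite iter_fix.
Qed.

(** One query is enough: state [inr None] submits the output of the pipe, and the transition that
    follows takes the first bit of the answer as the verdict. This is the one step added to the cost
    of the pipe. *)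
Lemma pipe_poly_turing (L : language) (S : search_problem) :
  (forall O, solves O S -> forall x, head false (O (f x)) <-> L x) ->
  poly_turing L S.
Proof.
move=> HL.
have [c [d cd]] := poly_boundedP (poly_bounded_add (poly_bounded_pipe_cost q)
                                    (poly_bounded_const 1)).
pose halt (s : driver_state (pipe q)) := if s is inr (Some _) then true else false.
pose ask (s : driver_state (pipe q)) := if s is inr None then true else false.
exists (@driver n W (pipe q) halt), ask, c, d => O HO x; cbv zeta.
have [t' Ht' [k kle ex]] := pipe_exits halt x.
have {}kle : k.+1 <= poly_bound c d (size x).
  by apply: leq_trans (cd _); rewrite addn1.
rewrite -(subnK kle) iterD iterS.
rewrite (@driver_exits n W (pipe q) halt
           (@oracle_step (@driver n W (pipe q) halt) ask O) k (entry (pipe q)) _ t') //.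
rewrite iter_fix // -(HL O HO x) /oracle_step /step /query /=.
rewrite (_ : output _ = f x); last exact: Ht'.
split=> //; rewrite /accepts /= !ffunE eqxx /read /=.
by case: (O (f x)) => [|[] z].
Qed.

End Pipes.

(** * Decoding instances *)

Section Encodings.

Lemma binaryE n : binary n = odd n :: (if n < 2 then [::] else binary n./2).
Proof.
rewrite /binary /=; congr (_ :: _); first by rewrite divn1.
case: ltnP => [|n2]; first by case: n => [|[]].
rewrite (trunc_log2S n2) -[1]/(1 + 0) iotaDl -map_comp.
by apply: eq_map => i /=; rewrite expnS divnMA divn2.
Qed.

Lemma binary_inj : injective binary.
Proof.
move=> n; have [k] := ubnP n; elim: k n => // k IHk n nk m; rewrite (binaryE n) (binaryE m).
case=> e; case: ltnP => n2; case: ltnP => m2.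
- by move=> _; move: e n2 m2; case: n nk => [|[|n]] // _; case: m => [|[|m]].
- by rewrite (binaryE m./2).
- by rewrite (binaryE n./2).
- move/IHk => H; rewrite -[n]odd_double_half -[m]odd_double_half e H //.
  lia.
Qed.

Lemma binary_exp2 k : binary (2 ^ k) = rcons (nseq k false) true.
Proof.
elim: k => [|k IHk]; rewrite binaryE // expnS ifF.
  by rewrite mul2n odd_double doubleK IHk.
have P : 0 < 2 ^ k by rewrite expn_gt0.
by apply/negbTE; rewrite -leqNgt -{1}[2]muln1 leq_mul.
Qed.

Lemma binary_exp2_pred k : binary (2 ^ k.+1).-1 = nseq k.+1 true.
Proof.
elim: k => [|k IHk]; rewrite binaryE // expnS.
set m := 2 ^ k.+1 in IHk *; have m_gt1 : 1 < m by rewrite /m expnS; have := expn_gt0 2 k; lia.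
rewrite ifF; last by lia.
have -> : (2 * m).-1 = true + m.-1.*2 by lia.
by rewrite oddD odd_double half_bit_double IHk.
Qed.

(** Allowing arbitrary continuations makes the property stable under concatenation. It is needed
    because the two problems only say that some instance has the given code, so this instance must
    be shown to be the one that was written. *)
Definition prefix_injective (T : Type) (enc : T -> seq bool) :=
  forall a b r r', enc a ++ r = enc b ++ r' -> a = b /\ r = r'.

Lemma enc_seq_cons (T : Type) (enc : T -> seq bool) a s :
  enc_seq enc (a :: s) = true :: enc a ++ enc_seq enc s.
Proof. by rewrite /enc_seq /= -catA. Qed.

Lemma enc_seq_injective (T : Type) (enc : T -> seq bool) :
  prefix_injective enc -> prefix_injective (enc_seq enc).
Proof.
move=> H; elim=> [|a s IHs] [|b s'] r r'; rewrite ?enc_seq_cons; try by case.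
rewrite !cat_cons -(catA (enc a)) -(catA (enc b)) => -[] /H [-> H2].
by have [-> ->] := IHs _ _ _ H2.
Qed.

Lemma prefix_injective_pair (T U : Type) (enc : T -> seq bool) (enc' : U -> seq bool) :
  prefix_injective enc -> prefix_injective enc' ->
  prefix_injective (fun p => enc p.1 ++ enc' p.2).
Proof. by move=> H H' [a b] [c d] r r'; rewrite -!catA => /H [/= -> /H' [-> ->]]. Qed.

Lemma enc_nat_injective : prefix_injective enc_nat.
Proof.
move=> n m r r' /(@enc_seq_injective bool) [|/binary_inj -> ->] //.
by move=> a b s s' [-> ->].
Qed.

Local Open Scope ring_scope.

Lemma enc_rat_injective : prefix_injective enc_rat.
Proof.
move=> a b r r'; move=> E; have es : (a < 0) = (b < 0) := congr1 (head true) E.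
have natsP := prefix_injective_pair enc_nat_injective enc_nat_injective.
have [[en ed] ->] := natsP (_, _) (_, _) _ _ (congr1 behead E).
split=> //.
rewrite -[a]divq_num_den -[b]divq_num_den.
have -> : denq a = denq b.
  by rewrite -(gez0_abs (denq_ge0 a)) -(gez0_abs (denq_ge0 b)) ed.
suff -> : numq a = numq b by [].
move: es; rewrite -(numq_lt0 a) -(numq_lt0 b) => es.
by move: en es; lia.
Qed.

Lemma map_enum_ord_inj (n : nat) (T : Type) (f g : 'I_n -> T) :
  [seq f i | i <- enum 'I_n] = [seq g i | i <- enum 'I_n] -> f = g.
Proof.
move=> H; apply: functional_extensionality => i.
have nthE (h : 'I_n -> T) : nth (f i) [seq h i | i <- enum 'I_n] i = h i.
  by rewrite (nth_map i) ?size_enum_ord // nth_ord_enum.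
by rewrite -(nthE f) H nthE.
Qed.

Lemma enc_grp_injective : prefix_injective enc_grp.
Proof.
case=> n m sk w ds th bu [n' m' sk' w' ds' th' bu'] r r'.
rewrite /enc_grp /enc_fun.
(* As lists of lists, the tables have types free of the dimensions and can be compared before the
   dimensions are known to agree. *)
have rowE k l (f : 'I_k -> 'I_l -> rat) :
  enc_seq (fun u => enc_seq enc_rat [seq f u i | i <- enum 'I_l]) [seq id i | i <- enum 'I_k]
  = enc_seq (enc_seq enc_rat) [seq [seq f u i | i <- enum 'I_l] | u <- enum 'I_k].
  by rewrite /enc_seq map_id -map_comp.
rewrite !rowE.
have rowsP := enc_seq_injective (enc_seq_injective enc_rat_injective).
have rowP := enc_seq_injective enc_rat_injective.
have allP := prefix_injective_pair rowsP (prefix_injective_pair rowP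
  (prefix_injective_pair rowsP (prefix_injective_pair rowP enc_rat_injective))).
move=> /(allP (_, (_, (_, (_, _)))) (_, (_, (_, (_, _))))) [[e1 e2 e3 e4 e5] ->].
have sizeE k (f : 'I_k -> rat) : size [seq f i | i <- enum 'I_k] = k.
  by rewrite size_map size_enum_ord.
(* The dimensions are read off the wages and the thresholds: without workers, the skill table would
   not show the number of domains. *)
split=> //; have /(congr1 size) := e2; rewrite !sizeE => /= en.
have /(congr1 size) := e4; rewrite !sizeE => /= em.
move: en em e5 => en em <-; move: en em sk' w' ds' th' e1 e2 e3 e4 => <- <-.
move=> sk' w' ds' th' /map_enum_ord_inj e1 /map_enum_ord_inj <-.
move=> /map_enum_ord_inj e3 /map_enum_ord_inj <-.
have <- : sk = sk'.
  apply: functional_extensionality => u.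
  by apply: map_enum_ord_inj; have := congr1 (@^~ u) e1.
suff <- : ds = ds' by [].
apply: functional_extensionality => u.
by apply: map_enum_ord_inj; have := congr1 (@^~ u) e3.
Qed.

End Encodings.

(** * Instances that are covering problems *)

Section Pairs.

Variables (A : finType) (a0 : A).

Definition row_of (k : nat) : nat := k %/ #|A|.
Definition item_of (k : nat) : A := nth a0 (enum A) (k %% #|A|).

Lemma row_of_lt N (u : 'I_(N * #|A|)) : row_of u < N.
Proof.
have uN := ltn_ord u; rewrite ltn_divLR // lt0n.
by apply: contraTneq (leq_ltn_trans (leq0n u) uN) => ->; rewrite muln0.
Qed.

Lemma pair_index_lt N (j : 'I_N) (a : A) : j * #|A| + index a (enum A) < N * #|A|.
Proof.
have : index a (enum A) < #|A| by rewrite cardE index_mem mem_enum.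
by have := ltn_ord j; nia.
Qed.

Definition pair_index N (j : 'I_N) (a : A) : 'I_(N * #|A|) := Ordinal (pair_index_lt j a).

Lemma row_pair_index N (j : 'I_N) a : row_of (pair_index j a) = j.
Proof.
have A_gt0 : 0 < #|A| by apply/card_gt0P; exists a.
rewrite /row_of /= divnMDl // divn_small ?addn0 //.
by rewrite cardE index_mem mem_enum.
Qed.

Lemma item_pair_index N (j : 'I_N) a : item_of (pair_index j a) = a.
Proof.
rewrite /item_of /= modnMDl modn_small ?nth_index ?mem_enum //.
by rewrite cardE index_mem mem_enum.
Qed.

Lemma pair_indexK N (u : 'I_(N * #|A|)) (j : 'I_N) a :
  row_of u = j -> item_of u = a -> u = pair_index j a.
Proof.
move=> uj ua; apply: val_inj; rewrite /= -uj -ua /item_of index_uniq ?enum_uniq //.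
  by rewrite -divn_eq.
by rewrite -cardE ltn_mod; apply/card_gt0P; exists a.
Qed.

(** This turns the single enumeration of an encoding into a loop over cells around a finite list,
    the shape that an emitter can follow. *)
Lemma map_enum_pairs N (T : Type) (F : nat -> A -> T) :
  [seq F (row_of u) (item_of u) | u : 'I_(N * #|A|) <- enum 'I_(N * #|A|)] =
  flatten [seq [seq F j a | a <- enum A] | j <- iota 0 N].
Proof.
have A_gt0 : 0 < #|A| by apply/card_gt0P; exists a0.
pose H u := F (row_of u) (item_of u).
rewrite (map_comp H val) val_enum_ord; elim: N => [|N IHN]; first by rewrite mul0n.
rewrite mulSnr iotaD map_cat IHN -addn1 iotaD map_cat flatten_cat /= cats0.
congr (_ ++ _); rewrite !add0n.
rewrite -[N * _]addn0 iotaDl -map_comp.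
apply: (@eq_from_nth _ (F 0 a0)); first by rewrite 2!size_map size_iota cardE.
move=> i; rewrite size_map size_iota => ia.
rewrite (nth_map 0) ?size_iota // nth_iota // (nth_map a0) -?cardE //.
by rewrite /= /H /row_of /item_of divnMDl // modnMDl divn_small ?modn_small ?addn0.
Qed.

End Pairs.

Section CoverInstance.

Variables (colour domain : finType) (g0 : colour) (d0 : domain) (N : nat).
Variable covers : nat -> colour -> nat -> domain -> bool.

Local Open Scope ring_scope.

(* Workers are the pairs (cell, colour); the wages and the budget are such that
   a group with a worker in every cell has exactly one in each. *)
Definition cover_data : grp_data :=
  @GrpData (N * #|colour|) (N * #|domain|)
    (fun u i => (covers (row_of colour u) (item_of g0 u)
                        (row_of domain i) (item_of d0 i))%:R)
    (fun u => 2%:R ^- (row_of colour u).+1)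
    (fun _ _ => 0)
    (fun _ => 1)
    (1 - 2%:R ^- N).

Lemma exp2V_gt0 k : 0 < (2%:R ^- k : rat).
Proof. by rewrite invr_gt0 exprn_gt0. Qed.

Lemma exp2V_le1 k : (2%:R ^- k : rat) <= 1.
Proof. by rewrite invf_le1 ?exprn_gt0 // exprn_ege1. Qed.

Lemma sum_exp2V (n : nat) : \sum_(j < n) (2%:R ^- j.+1 : rat) = 1 - 2%:R ^- n.
Proof.
elim: n => [|n IHn]; first by rewrite big_ord0 expr0 invr1 subrr.
rewrite big_ord_recr IHn /= exprS invfM.
have := exp2V_gt0 n; set e := _ ^- _; lra.
Qed.

Lemma cover_instance : grp_instance cover_data.
Proof.
split=> /=.
- by move=> u i; case: (covers _ _ _ _).
- by move=> u; rewrite ltW ?exp2V_gt0 ?exp2V_le1.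
- by split=> // u v; rewrite lexx.
- by [].
- by rewrite subr_ge0 exp2V_le1.
Qed.

Lemma diameter_cover (G : {set 'I_(workers cover_data)}) : diameter G = 0.
Proof.
rewrite /diameter /=; apply: (big_ind (fun x => x = 0)) => //.
  by move=> x y -> ->; rewrite maxxx.
move=> u _; apply: (big_ind (fun x => x = 0)) => //.
by move=> x y -> ->; rewrite maxxx.
Qed.

Lemma sum_bool_gt0 (T : finType) (P : pred T) (b : T -> bool) :
  (1 <= \sum_(x | P x) (b x)%:R :> rat) = [exists x, P x && b x].
Proof.
apply/idP/existsP => [|[x /andP [Px bx]]].
  case: (pickP (fun x => P x && b x)) => [x|none]; first by exists x.
  rewrite big1 ?ler10 // => x Px.
  by have := none x; rewrite Px /= => ->.
by rewrite (bigD1 x) //= bx lerDl sumr_ge0 // => y _; case: (b y).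
Qed.

Variable own : domain.
Hypothesis own_covers : forall j' g j, (j < N)%N -> covers j' g j own -> j' = j.

Lemma cover_feasible :
  (exists G : {set 'I_(workers cover_data)}, feasible G) <->
  exists col : nat -> colour, forall j d, (j < N)%N ->
    exists2 j', (j' < N)%N & covers j' (col j') j d.
Proof.
pose cell (u : 'I_(N * #|colour|)) : 'I_N := Ordinal (row_of_lt u).
split=> [[G [Gcov Gcost]]|[col Hcol]].
  have hit j d : (j < N)%N -> exists2 u, u \in G & covers (cell u) (item_of g0 u) j d.
    move=> jN; set i := pair_index (Ordinal jN) d.
    have : 1 <= \sum_(u in G) (covers (row_of colour u) (item_of g0 u)
                     (row_of domain i) (item_of d0 i))%:R :> rat by exact: Gcov i.
    rewrite sum_bool_gt0 row_pair_index item_pair_index => /existsP [u /andP [uG uc]].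
    by exists u.
  pose col (j : nat) := if [pick u in G | cell u == j :> nat] is Some u
                        then item_of g0 u else g0.
  have pickcol j : (j < N)%N -> exists2 v, v \in G & cell v = j :> nat /\ col j = item_of g0 v.
    move=> jN; have [u uG /own_covers uj] := hit j own jN.
    rewrite /col; case: pickP => [v /andP [vG /eqP vj]|/(_ u)]; first by exists v.
    by rewrite uG (uj jN) eqxx.
  (* [H] keeps one worker per cell, the one with the colour chosen for it; these workers alone
     already cost the whole budget. *)
  pose H := [set u in G | item_of g0 u == col (cell u)].
  have Hcost : 1 - 2%:R ^- N <= \sum_(u in H) wage (g := cover_data) u.
    rewrite -sum_exp2V (partition_big cell xpredT) //=; apply: ler_sum => j _.
    have [v vG [vj colj]] := pickcol j (ltn_ord j).
    have vH : v \in H by rewrite inE vG vj colj eqxx.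
    rewrite (bigD1 v) /=; last by rewrite vH; apply/eqP/val_inj.
    rewrite (vj : row_of colour v = j) lerDl sumr_ge0 // => u _.
    exact/ltW/exp2V_gt0.
  (* A worker of [G] outside [H] would add a positive wage to an exhausted budget. *)
  have GH u : u \in G -> item_of g0 u = col (cell u).
    move=> uG; apply/eqP; apply: contraT => Hu; move: Gcost.
    rewrite /= (big_setID H) /= (setIidPr _); last by apply/subsetP => v /setIdP [].
    rewrite [X in _ + X](bigD1 u) /=; last by apply/setDP; rewrite inE uG.
    set rest := \sum_(i in G :\: H | _) _; have : 0 <= rest.
      by apply: sumr_ge0 => v _; apply/ltW/exp2V_gt0.
    have := exp2V_gt0 (row_of colour u).+1; move: Hcost => /=; lra.
  exists col => j d /(hit j d) [u uG].
  by rewrite (GH u uG); exists (cell u).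
pose G := [set u : 'I_(N * #|colour|) | item_of g0 u == col (row_of colour u)].
exists G; split=> /= [i|].
  rewrite sum_bool_gt0; have [j' jN Hj'] := Hcol _ (item_of d0 i) (row_of_lt i).
  apply/existsP; exists (pair_index (Ordinal jN) (col j')).
  by rewrite inE row_pair_index item_pair_index eqxx.
rewrite -sum_exp2V (partition_big cell xpredT) //=; apply: ler_sum => j _.
rewrite (big_pred1 (pair_index j (col j))) ?row_pair_index // => u.
rewrite inE; apply/andP/eqP => [[/eqP cu /eqP <-]|->].
  by apply: (@pair_indexK _ g0); rewrite // cu.
split; first by rewrite item_pair_index row_pair_index.
by apply/eqP/val_inj; rewrite /= row_pair_index.
Qed.

Lemma enc_rat_bool (b : bool) :
  enc_rat b%:R = [:: false; true; b; false; true; true; false].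
Proof. by case: b. Qed.

Lemma enc_rat_frac (a k : nat) : coprime a (2 ^ k) ->
  enc_rat (a%:R / 2%:R ^+ k) = false :: enc_nat a ++ enc_nat (2 ^ k).
Proof.
move=> co; have -> : a%:R / 2%:R ^+ k = (Posz a)%:~R / (Posz (2 ^ k))%:~R :> rat.
  by rewrite -natrX -!pmulrn.
have k_gt0 : (0 < 2 ^ k)%N by rewrite expn_gt0.
rewrite /enc_rat coprimeq_num ?coprimeq_den // gtr0_sg; last by rewrite ltz_nat.
rewrite ifF; last by apply/negbTE; rewrite eqz_nat -lt0n.
rewrite mul1r -!pmulrn !absz_nat ltNge divr_ge0 ?ler0n //.
Qed.

Lemma enc_nat_exp2 k :
  enc_nat (2 ^ k) = flatten (nseq k [:: true; false]) ++ [:: true; true; false].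
Proof.
rewrite /enc_nat /enc_seq binary_exp2 map_rcons flatten_rcons -catA; congr (flatten _ ++ _).
by elim: k => //= k ->.
Qed.

Lemma enc_rat_exp2V k : enc_rat (2%:R ^- k) =
  [:: false; true; true; false] ++ flatten (nseq k [:: true; false]) ++
  [:: true; true; false].
Proof.
have := @enc_rat_frac 1 k (coprime1n _).
by rewrite mul1r => ->; rewrite enc_nat_exp2.
Qed.

(** An odd numerator is coprime to a power of two, so the fraction is in lowest terms. The exponent
    is a successor because 0 is written with one digit, not as an empty run of ones. *)
Lemma enc_rat_budget k : enc_rat (1 - 2%:R ^- k.+1) =
  false :: flatten (nseq k.+1 [:: true; true]) ++ [:: false] ++
  flatten (nseq k.+1 [:: true; false]) ++ [:: true; true; false].
Proof.
have e_gt0 : (0 < 2 ^ k.+1)%N by rewrite expn_gt0.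
have -> : 1 - 2%:R ^- k.+1 = (2 ^ k.+1).-1%:R / 2%:R ^+ k.+1 :> rat.
  rewrite -subn1 natrB // natrX mulrBl mul1r mulfV //.
  by rewrite expf_neq0.
rewrite enc_rat_frac; last by rewrite coprimePn.
by rewrite enc_nat_exp2 /enc_nat binary_exp2_pred /enc_seq map_nseq -catA.
Qed.

Definition grid (A : finType) (F : nat -> A -> seq bool) : seq bool :=
  flatten [seq flatten [seq true :: F j a | a <- enum A] | j <- iota 0 N] ++ [:: false].

Lemma enc_fun_grid (A : finType) (a0 : A) (T : Type) (enc : T -> seq bool)
    (f : 'I_(N * #|A|) -> T) (F : nat -> A -> seq bool) :
  (forall u, enc (f u) = F (row_of A u) (item_of a0 u)) -> enc_fun enc f = grid F.
Proof.
move=> encE; rewrite /enc_fun /enc_seq /grid -map_comp; congr (_ ++ _).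
rewrite (eq_map (g := fun u : 'I_(N * #|A|) =>
          true :: F (row_of A u) (item_of a0 u))) => [|u]; last by rewrite /= encE.
rewrite (map_enum_pairs a0 N (fun j a => true :: F j a)).
by elim: (iota 0 N) => //= j s IHs; rewrite flatten_cat IHs.
Qed.

Lemma enc_cover : (0 < N)%N -> enc_grp cover_data =
  grid (fun j' g => grid (fun j d =>
          [:: false; true; covers j' g j d; false; true; true; false])) ++
  grid (fun j' (_ : colour) => [:: false; true; true; false] ++
          flatten (nseq j'.+1 [:: true; false]) ++ [:: true; true; false]) ++
  grid (fun _ (_ : colour) => grid (fun _ (_ : colour) => enc_rat 0)) ++
  grid (fun _ (_ : domain) => enc_rat 1) ++
  false :: flatten (nseq N [:: true; true]) ++ [:: false] ++
  flatten (nseq N [:: true; false]) ++ [:: true; true; false].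
Proof.
move=> N_gt0; rewrite /enc_grp -[budget _]/(1 - 2%:R ^- N).
have -> : enc_rat (1 - 2%:R ^- N) = false :: flatten (nseq N [:: true; true]) ++
    [:: false] ++ flatten (nseq N [:: true; false]) ++ [:: true; true; false].
  by rewrite -(prednK N_gt0) enc_rat_budget.
congr (_ ++ (_ ++ (_ ++ (_ ++ _)))).
- apply: (enc_fun_grid (a0 := g0)) => u; apply: (enc_fun_grid (a0 := d0)) => i.
  by rewrite -enc_rat_bool.
- by apply: (enc_fun_grid (a0 := g0)) => u; rewrite -enc_rat_exp2V.
- apply: (enc_fun_grid (a0 := g0)) => u.
  exact: (enc_fun_grid (a0 := g0)).
- exact: (enc_fun_grid (a0 := d0)).
Qed.

End CoverInstance.

(** * Tableaux *)

(* The place of a cell in the tableau: is it in the first column, the last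
   column, the first row, the last row, then the input bit of its column and
   whether a witness bit may stand there. *)
Definition label : finType := (bool * bool * bool * bool * option bool * bool)%type.

Definition in_head (l : label) : bool := l.1.1.1.1.1.
Definition in_end (l : label) : bool := l.1.1.1.1.2.
Definition in_first (l : label) : bool := l.1.1.1.2.
Definition in_last (l : label) : bool := l.1.1.2.
Definition x_bit (l : label) : option bool := l.1.2.
Definition y_allowed (l : label) : bool := l.2.

Section Tableau.

Variable M : machine.

Let sym := symbol (work M).
Let syms : finType := {ffun 'I_(tapes_pred M).+1 -> sym}.

(* Column p of a row describes, on every tape, the cells at distance p to the
   left and to the right of the head, so that the heads do not move. The state
   and the scanned symbols are repeated in every column. *)
Definition colour : finType := (label * state M * syms * syms * syms * option bool)%type.

Definition c_label (g : colour) : label := g.1.1.1.1.1.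
Definition c_state (g : colour) : state M := g.1.1.1.1.2.
Definition c_reads (g : colour) : syms := g.1.1.1.2.
Definition c_left (g : colour) : syms := g.1.1.2.
Definition c_right (g : colour) : syms := g.1.2.
Definition c_y (g : colour) : option bool := g.2.

Definition transition (q : state M) (r : syms) :
    state M * ('I_(tapes_pred M).+1 -> sym * direction) :=
  if halting q then (q, fun i => (r i, Stay)) else delta q r.

(** The witness is guessed through [c_y] in row 0: [y_allowed] limits its length, and [window_ok]
    keeps its bits contiguous from column 0. The list indexed by [val i] places the input on tape 0
    and the witness on tape 1. *)
Definition cell_ok (l : label) (g : colour) : bool :=
  [&& c_label g == l,
      in_first l ==>
        [&& c_state g == start M, [forall i, c_left g i == None],
            [forall i, c_right g i == omap inl (nth None [:: x_bit l; c_y g] (val i))]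
          & y_allowed l || (c_y g == None)]
    & in_last l && in_head l ==> accepting (c_state g)].

(** A head move shifts the two half-tapes in opposite senses. The half shifted towards the head
    takes its symbol from the next column, the other half passes its symbol on to the next column,
    and in column 0 ([h]) a symbol crosses from one half to the other. [Rw] is the right-hand symbol
    after writing. *)
Definition tape_ok (h : bool) (a : sym * direction) (La Ra Lb Rb La' Ra' Lb' Rb' : sym) :=
  let Rw := if h then a.1 else Ra in
  match a.2 with
  | Stay => (La' == La) && (Ra' == Rw)
  | ToLeft => [&& La' == Lb, Rb' == Rw & h ==> (Ra' == La)]
  | ToRight => [&& Ra' == Rb, Lb' == La & h ==> (La' == a.1)]
  end.

(* The colours a b above the colours a' b'. *)
Definition window_ok (a b a' b' : colour) : bool :=
  let l := c_label a in
  [|| in_end l, in_last l |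
   [&& in_first l && (c_y a == None) ==> (c_y b == None),
       c_state b == c_state a, c_reads b == c_reads a,
       in_head l ==> (c_reads a == c_right a),
       c_state a' == (transition (c_state a) (c_reads a)).1
     & [forall i, tape_ok (in_head l) ((transition (c_state a) (c_reads a)).2 i)
          (c_left a i) (c_right a i) (c_left b i) (c_right b i)
          (c_left a' i) (c_right a' i) (c_left b' i) (c_right b' i)]]].

Definition scanned (c : config M) : syms := [ffun i => read (ctapes c i)].
Definition lefts (c : config M) (p : nat) : syms :=
  [ffun i => nth None (tleft (ctapes c i)) p].
Definition rights (c : config M) (p : nat) : syms :=
  [ffun i => nth None (tright (ctapes c i)) p].

Lemma scanned_rights c : scanned c = rights c 0.
Proof. by apply/ffunP => i; rewrite !ffunE /read -nth0. Qed.

Lemma step_state c : cstate (step c) = (transition (cstate c) (scanned c)).1.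
Proof.
rewrite /step /halted /transition; case: ifP => // _.
by case: (delta _ _).
Qed.

Lemma step_tapes c i : let a := (transition (cstate c) (scanned c)).2 i in
  let w p := if p == 0 then a.1 else rights c p i in
  match a.2 with
  | Stay => (forall p, lefts (step c) p i = lefts c p i) /\
            (forall p, rights (step c) p i = w p)
  | ToLeft => [/\ forall p, lefts (step c) p i = lefts c p.+1 i,
                  rights (step c) 0 i = lefts c 0 i &
                  forall p, rights (step c) p.+1 i = w p]
  | ToRight => [/\ lefts (step c) 0 i = a.1,
                   forall p, lefts (step c) p.+1 i = lefts c p i &
                   forall p, rights (step c) p i = rights c p.+1 i]
  end.
Proof.
rewrite /step /halted /transition; case: ifP => /= _.
  split=> // p; case: p => //=; by rewrite scanned_rights.
rewrite -/(scanned c); case: (delta _ _) => q act /=.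
case E: (act i) => [s d] /=; case: d E => E.
- split=> [p||p]; rewrite !ffunE E /=; first by rewrite nth_behead.
    by rewrite nth0.
  by case: p => //= p; rewrite nth_behead.
- split=> [|p|p]; rewrite !ffunE E //=; by rewrite nth_behead.
- split=> p; rewrite !ffunE E //=.
  by case: p => //= p; rewrite nth_behead.
Qed.

Variables (m P : nat) (x : seq bool).
Hypothesis m_gt1 : 1 < m.

Definition label_at (t p : nat) : label :=
  (p == 0, p == m.-1, t == 0, t == m.-1, nth None [seq Some b | b <- x] p, p < P).

Definition tableau (col : nat -> nat -> colour) : Prop :=
  (forall t p, t < m -> p < m -> cell_ok (label_at t p) (col t p)) /\
  (forall t p, t.+1 < m -> p.+1 < m ->
     window_ok (col t p) (col t p.+1) (col t.+1 p) (col t.+1 p.+1)).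

Definition run (y : seq bool) (t : nat) : config M := iter t (@step M) (init M [:: x; y]).

Definition true_colour (y : seq bool) (t p : nat) : colour :=
  (label_at t p, cstate (run y t), scanned (run y t), lefts (run y t) p,
   rights (run y t) p, nth None [seq Some b | b <- y] p).

Lemma init_rights y p i : rights (init M [:: x; y]) p i =
  omap inl (nth None [:: nth None [seq Some b | b <- x] p;
                         nth None [seq Some b | b <- y] p] (val i)).
Proof.
rewrite !ffunE /=.
have bits z : nth None [seq Some (inl b) | b <- z] p =
    omap inl (nth None [seq Some b | b <- z] p) :> sym.
  by elim: z p => [|b z IHz] [|p] //=; rewrite IHz.
by case: i => -[|[|i]] lti /=; rewrite ?bits ?nth_nil.
Qed.

Lemma run_tableau y : size y <= P -> accepting (cstate (run y m.-1)) ->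
  tableau (true_colour y).
Proof.
move=> yP acc; split=> t p tm pm.
  apply/and3P; split; first by [].
    apply/implyP => /eqP ->; apply/and4P; split.
    - by [].
    - by apply/forallP => i; rewrite !ffunE /= nth_nil.
    - by apply/forallP => i; apply/eqP; exact: init_rights.
    - rewrite /y_allowed /=; case: ltnP => //= Pp.
      by rewrite /c_y /= nth_default // size_map (leq_trans yP).
  by apply/implyP => /andP [/eqP tm1 _]; rewrite /c_state /= tm1.
apply/or3P/Or33; apply/and5P; rewrite /c_y /c_state /c_reads /=; split.
- apply/implyP => /andP [_ /eqP yp]; apply/eqP.
  rewrite nth_default // size_map leqNgt; apply: contra_eqN yp => py.
  by rewrite (nth_map false) // ltnW.
- by [].
- by [].
- by apply/implyP => /eqP ->; rewrite scanned_rights.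
- apply/andP; split; first by rewrite step_state.
  apply/forallP => i; have := step_tapes (run y t) i; rewrite /tape_ok /=.
  rewrite /c_left /c_right /=.
  case: (_.2 i) => a [] /=.
  + case=> -> H0 ->; rewrite !eqxx /=.
    by apply/implyP => /eqP ->; rewrite H0.
  + case=> H0 -> ->; rewrite !eqxx /=.
    by apply/implyP => /eqP ->; rewrite H0.
  + by case=> -> ->; rewrite !eqxx.
Qed.

(** No window starts in the last column, so wrong symbols may enter there, but they advance by at
    most one column per row. The colours are therefore forced in the triangle [p + t < m], which
    contains column 0 of the last row, where acceptance is checked. *)
Lemma tableau_run col : tableau col ->
  exists2 y, size y <= P & accepting (cstate (run y m.-1)).
Proof.
case=> cells windows.
have labE t p : t < m -> p < m -> c_label (col t p) = label_at t p.
  by move=> tm pm; have /and3P [/eqP] := cells t p tm pm.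
have windowE t p : t.+1 < m -> p.+1 < m ->
    [&& (t == 0) && (c_y (col t p) == None) ==> (c_y (col t p.+1) == None),
       c_state (col t p.+1) == c_state (col t p),
       c_reads (col t p.+1) == c_reads (col t p),
       (p == 0) ==> (c_reads (col t p) == c_right (col t p)),
       c_state (col t.+1 p) == (transition (c_state (col t p)) (c_reads (col t p))).1
     & [forall i, tape_ok (p == 0)
          ((transition (c_state (col t p)) (c_reads (col t p))).2 i)
          (c_left (col t p) i) (c_right (col t p) i)
          (c_left (col t p.+1) i) (c_right (col t p.+1) i)
          (c_left (col t.+1 p) i) (c_right (col t.+1 p) i)
          (c_left (col t.+1 p.+1) i) (c_right (col t.+1 p.+1) i)]].
  move=> tm pm; move: (windows t p tm pm).
  rewrite /window_ok (labE t p (ltnW tm) (ltnW pm)).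
  have -> : in_end (label_at t p) = false by rewrite /in_end /=; lia.
  have -> : in_last (label_at t p) = false by rewrite /in_last /=; lia.
  exact: id.
have firstE p : p < m ->
    [&& c_state (col 0 p) == start M, [forall i, c_left (col 0 p) i == None],
        [forall i, c_right (col 0 p) i ==
          omap inl (nth None [:: nth None [seq Some b | b <- x] p; c_y (col 0 p)] (val i))]
      & (p < P) || (c_y (col 0 p) == None)].
  by move=> pm; have /and3P [_ /implyP /(_ isT)] := cells 0 p (ltnW m_gt1) pm.
(* The witness is made of the bits of row 0 before the first blank; blanks propagate to the right,
   so no bit is lost. *)
have [y yP yE] : exists2 y, size y <= P &
    forall p, p < m -> c_y (col 0 p) = nth None [seq Some b | b <- y] p.
  pose blank p := c_y (col 0 p) == None.
  have blankS p d : p + d < m -> blank p -> blank (p + d).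
    elim: d => [|d IHd]; rewrite ?addn0 ?addnS // => ltm bp.
    have /and3P [/implyP yS _ _] := windowE 0 (p + d) m_gt1 ltm.
    by apply: yS; apply: IHd bp; exact: ltnW.
  pose k := find blank (iota 0 m).
  have k_le : k <= m by have := find_size blank (iota 0 m); rewrite size_iota.
  have bits p : p < k -> ~~ blank p.
    by move=> pk; have := before_find 0 pk; rewrite nth_iota ?(leq_trans pk) // => ->.
  exists [seq odflt false (c_y (col 0 p)) | p <- iota 0 k].
    rewrite size_map size_iota leqNgt; apply/negP => Pk.
    have /and4P [_ _ _] := firstE P (leq_trans Pk k_le).
    by rewrite ltnn /=; apply/negP; exact: bits.
  move=> p pm; case: (ltnP p k) => [pk|kp].
    rewrite (nth_map false) ?size_map ?size_iota // (nth_map 0) ?size_iota // nth_iota //.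
    by have := bits p pk; rewrite /blank; case: (c_y _).
  rewrite nth_default ?size_map ?size_iota //; apply/eqP.
  rewrite -(subnKC kp); apply: blankS; first by rewrite subnKC.
  have km : k < size (iota 0 m) by rewrite size_iota (leq_ltn_trans kp).
  have := nth_find 0 (a := blank) (s := iota 0 m); rewrite has_find => /(_ km).
  by rewrite -/k nth_iota // (leq_ltn_trans kp).
exists y => //.
pose truth t p := [/\ c_state (col t p) = cstate (run y t),
  c_left (col t p) = lefts (run y t) p & c_right (col t p) = rights (run y t) p].
have inv t : forall p, p + t < m -> truth t p.
  elim: t => [|t IHt] p.
    rewrite addn0 => pm; have /and4P [/eqP q0 /forallP L0 /forallP R0 _] := firstE p pm.
    split=> //; apply/ffunP => i; first by rewrite (eqP (L0 i)) !ffunE /= nth_nil.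
    by rewrite (eqP (R0 i)) init_rights yE.
  rewrite addnS => ptm.
  (* The scanned symbols are fixed in column 0 and copied along the row by the windows. *)
  have readsE p' : p' + t.+1 < m -> c_reads (col t p') = scanned (run y t).
    elim: p' => [|p' IHp] ltm.
      have [_ _ Rt] := IHt 0 ltac:(lia).
      have /and5P [_ _ _ /implyP /(_ isT) /eqP -> _] := windowE t 0 ltac:(lia) ltac:(lia).
      by rewrite Rt scanned_rights.
    have /and3P [_ _ /andP [/eqP -> _]] := windowE t p' ltac:(lia) ltac:(lia).
    by apply: IHp; lia.
  have [qt Lt Rt] := IHt p ltac:(lia).
  have [_ Lt1 Rt1] := IHt p.+1 ltac:(lia).
  have := windowE t p ltac:(lia) ltac:(lia).
  rewrite (readsE p); last by lia.
  rewrite qt Lt Rt Lt1 Rt1 -step_state => /and5P [_ _ _ _ /andP [/eqP qt1 /forallP tapes]].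
  (* A symbol moving away from the head arrives from the previous column, so it is governed by the
     window that starts there. *)
  have left_window i p' : p = p'.+1 ->
      tape_ok (p' == 0) ((transition (cstate (run y t)) (scanned (run y t))).2 i)
        (lefts (run y t) p' i) (rights (run y t) p' i)
        (lefts (run y t) p i) (rights (run y t) p i)
        (c_left (col t.+1 p') i) (c_right (col t.+1 p') i)
        (c_left (col t.+1 p) i) (c_right (col t.+1 p) i).
    move=> pE; have [qp Lp Rp] := IHt p' ltac:(lia).
    have := windowE t p' ltac:(lia) ltac:(lia).
    rewrite -pE (readsE p'); last by lia.
    by rewrite qp Lp Rp Lt Rt => /and5P [_ _ _ _ /andP [_ /forallP]].
  split=> //; apply/ffunP => i; move: (tapes i) (left_window i) (step_tapes (run y t) i);
    rewrite /tape_ok /=; clear - x y col t p i; case: (_.2 i) => a [] /=.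
  - by move=> /and3P [/eqP -> _ _] _ [-> _ _].
  - case: p => [/and3P [_ _ /eqP ->] _ [-> _ _] //|p _ /(_ p erefl) /and3P [_ /eqP -> _]].
    by case=> _ ->.
  - by move=> /andP [/eqP -> _] _ [->].
  - case: p => [/and3P [_ _ /eqP ->] _ [_ -> _] //|p _ /(_ p erefl) /and3P [_ /eqP -> _]].
    by case=> _ _ ->.
  - by move=> /and3P [/eqP -> _ _] _ [_ _ ->].
  - by move=> /andP [_ /eqP ->] _ [_ ->].
have [<- _ _] := inv m.-1 0 ltac:(lia).
have m1 : m.-1 < m by lia.
have /and3P [_ _ /implyP acc] := cells m.-1 0 m1 (ltnW m_gt1).
by apply: acc; rewrite /in_last /in_head /= eqxx.
Qed.

End Tableau.

(** * Tableaux as coverings *)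

(* Besides its labels the reduction uses pairs of bits, as the offset (row,
   column) of a cell in a window and as the flags (first, last). *)
Definition extra : finType := (label + bool * bool)%type.

Definition pair_letter (r c : bool) : bool + extra := inr (inr (r, c)).

Section Covering.

Variable M : machine.

(* The domain None of a cell asks for an admissible colour in it; the domain
   Some (g0, g1, g2, g3) excludes these colours from the window at the cell
   unless they satisfy window_ok. *)
Definition demand : finType :=
  option (colour M * colour M * colour M * colour M)%type.

(** [s] is the letter of the offset tape at the distance from the domain's cell to the worker's
    cell; a blank or a filler means that the worker lies outside the window. *)
Definition entry_bit (d : demand) (g : colour M) (l : label) (s : symbol extra) : bool :=
  match d with
  | None => (s == Some (pair_letter false false)) && cell_ok l g
  | Some (g0, g1, g2, g3) => window_ok g0 g1 g2 g3 ||
      match s with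
      | Some (inr (inr (r, c))) =>
          g != (if r then if c then g3 else g2 else if c then g1 else g0)
      | _ => false
      end
  end.

Variables (m P : nat) (x : seq bool).
Hypothesis m_gt1 : 1 < m.

(* The offsets of the cells of a window, the tableau being listed row by row. *)
Definition offsets : seq (bool + extra) :=
  [:: pair_letter false false; pair_letter false true] ++
  nseq (m - 2) (inl true) ++ [:: pair_letter true false; pair_letter true true].

Local Open Scope ring_scope.

(** As [m > 1], the places 0, 1, [m] and [m + 1] are distinct, so each pair letter occurs exactly
    once. *)
Lemma word_offsets z r c :
  (word offsets z == Some (pair_letter r c)) = (z == (r * m + c)%N%:Z).
Proof.
have pairE a b : (Some (pair_letter a b) == Some (pair_letter r c)) = (a == r) && (b == c).
  by case: a; case: b; case: r; case: c.
case: z => [k|k] //; rewrite eqz_nat /offsets.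
case: k => [|[|k]].
- by rewrite pairE; case: (r); case: (c); rewrite /=; lia.
- by rewrite pairE; case: (r); case: (c); rewrite /=; lia.
rewrite /word map_cat nth_cat /= map_cat nth_cat map_nseq size_nseq nth_nseq !subSS subn0.
case: ltnP => [km|mk].
  rewrite (_ : _ == _ = false) //; by case: (r); case: (c); rewrite /=; lia.
case E: (k - (m - 2))%N => [|[|q]].
- by rewrite pairE; case: (r); case: (c); rewrite /=; lia.
- by rewrite pairE; case: (r); case: (c); rewrite /=; lia.
- rewrite /= nth_nil (_ : _ == _ = false) //.
  by case: (r); case: (c); rewrite /=; lia.
Qed.

Definition covers (j' : nat) (g : colour M) (j : nat) (d : demand) : bool :=
  entry_bit d g (label_at m P x (j' %/ m) (j' %% m)) (word offsets (j'%:Z - j%:Z)).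

Lemma covers_None j' g j : covers j' g j None -> j' = j.
Proof. by rewrite /covers /= word_offsets => /andP [/eqP]; lia. Qed.

Lemma tableau_covers :
  (exists col, tableau (M := M) m P x col) <->
  exists col, forall j d, (j < m * m)%N ->
    exists2 j', (j' < m * m)%N & covers j' (col j') j d.
Proof.
have m_gt0 : (0 < m)%N by lia.
have cellE t p : (p < m)%N -> ((t * m + p) %/ m = t /\ (t * m + p) %% m = p)%N.
  by move=> pm; rewrite divnMDl // divn_small // addn0 modnMDl modn_small.
split=> -[col Hcol]; last first.
  exists (fun t p => col (t * m + p)%N); split=> t p tm pm.
    have jm : (t * m + p < m * m)%N by nia.
    have [j' _ cj] := Hcol _ None jm; move: (cj); rewrite (covers_None cj).
    have [tE pE] := cellE t p pm.
    by rewrite /covers /entry_bit tE pE => /andP [].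
  have jm : (t * m + p < m * m)%N by nia.
  (* The demand chosen is the quadruple that the colouring itself shows in this window. No cell of
     the window disagrees with it, so only its legality can satisfy the demand. *)
  pose g r c := col ((t + r) * m + (p + c))%N.
  have := Hcol _ (Some (g 0 0, g 0 1, g 1 0, g 1 1)%N) jm.
  rewrite /g !addn0 !addn1 => -[j' _ /orP [//|]].
  case E: (word _ _) => [[//|[//|[r c]]]|//].
  move/eqP: E; rewrite (word_offsets _ r c) => /eqP E.
  have -> : j' = (t * m + p + (r * m + c))%N by lia.
  move/eqP; case: {E} r; case: c => []; case; congr col; lia.
exists (fun j => col (j %/ m)%N (j %% m)%N) => j d jm.
case: Hcol => cells windows.
have tm : (j %/ m < m)%N by rewrite ltn_divLR.
have pm : (j %% m < m)%N by rewrite ltn_mod.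
set t := (j %/ m)%N in tm *; set p := (j %% m)%N in pm *.
have jE : j = (t * m + p)%N by exact: divn_eq.
have here : word offsets (j%:Z - j%:Z) = Some (pair_letter false false).
  by apply/eqP; rewrite word_offsets subrr.
case: d => [[[[g0 g1] g2] g3]|]; last first.
  by exists j => //; rewrite /covers /entry_bit here eqxx /=; apply: cells.
case ok: (window_ok g0 g1 g2 g3); first by exists j; rewrite // /covers /= ok.
have at_offset (r c : bool) (g : colour M) : (t + r < m)%N -> (p + c < m)%N ->
    g = (if r then if c then g3 else g2 else if c then g1 else g0) ->
    col (t + r)%N (p + c)%N != g ->
    exists2 j', (j' < m * m)%N & 
      covers j' (col (j' %/ m)%N (j' %% m)%N) j (Some (g0, g1, g2, g3)).
  move=> trm pcm -> neq; exists ((t + r) * m + (p + c))%N; first by nia.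
  have [E1 E2] := cellE (t + r)%N _ pcm.
  rewrite /covers /entry_bit E1 E2 (_ : word _ _ = Some (pair_letter r c)).
    by rewrite /= neq orbT.
  by apply/eqP; rewrite word_offsets; lia.
have [e0|n0] := eqVneq (col t p) g0; last first.
  by apply: (at_offset false false g0); rewrite ?addn0.
have lab : c_label g0 = label_at m P x t p.
  by rewrite -e0; have /and3P [/eqP] := cells t p tm pm.
(* In the linear listing the offsets ignore the ends of rows and could wrap into the next row or
   leave the table. As [window_ok] fails, the label carried by [g0] rules out the last column and
   the last row. *)
have [tm1 pm1] : (t.+1 < m)%N /\ (p.+1 < m)%N.
  have : ~~ (in_end (c_label g0) || in_last (c_label g0)).
    by apply: contraFN ok => /orP [] H; rewrite /window_ok H ?orbT.
  by rewrite lab /in_end /in_last /=; lia.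
have [e1|n1] := eqVneq (col t p.+1) g1; last first.
  by apply: (at_offset false true g1); rewrite ?addn0 ?addn1.
have [e2|n2] := eqVneq (col t.+1 p) g2; last first.
  by apply: (at_offset true false g2); rewrite ?addn0 ?addn1.
have [e3|n3] := eqVneq (col t.+1 p.+1) g3; last first.
  by apply: (at_offset true true g3); rewrite ?addn0 ?addn1.
by have := windows t p tm1 pm1; rewrite e0 e1 e2 e3 ok.
Qed.

End Covering.

(** * Emitters for fixed words and for double loops *)

Section Combinators.

Variables (n : nat) (W : finType).

Let I := 'I_n.+1.
Let letter := (bool + W)%type.

Definition emit_all (es : seq (emitter n W)) : emitter n W :=
  foldr (@Both n W) (Emit (fun=> None)) es.

Definition emit_word (s : seq letter) : emitter n W :=
  emit_all [seq Emit (fun=> Some a) | a <- s].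

Definition emit_bits (b : seq bool) : emitter n W := emit_word [seq inl c | c <- b].

Definition still : I -> direction := fun=> Stay.
Definition moving (i : I) (d : direction) : I -> direction :=
  fun j => if j == i then d else Stay.

Definition emit_grid (i : I) (d : I -> direction) (A : finType)
    (F : A -> emitter n W) : emitter n W :=
  Both (For i d (emit_all [seq Both (emit_bits [:: true]) (F a) | a <- enum A]))
       (emit_bits [:: false]).

Variable o : I.

Lemma emitted_both (P1 P2 : emitter n W) s v :
  emitted o (Both P1 P2) s v = emitted o P1 s v ++ emitted o P2 s v.
Proof. by []. Qed.

Lemma emitted_for i d (P : emitter n W) s v : emitted o (For i d P) s v =
  flatten [seq emitted o P s (advance i d v k) | k <- iota 0 (size (s i))].
Proof. by []. Qed.

Lemma emitted_all es s v :
  emitted o (emit_all es) s v = flatten [seq emitted o P s v | P <- es].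
Proof. by elim: es => //= P es ->. Qed.

Lemma emitted_word a s v : emitted o (emit_word a) s v = a.
Proof. by rewrite emitted_all -map_comp; elim: a => //= b a ->. Qed.

Lemma emitted_bits b s v : emitted o (emit_bits b) s v = [seq inl c | c <- b].
Proof. exact: emitted_word. Qed.

Lemma well_formed_all dirty es : all (well_formed o dirty) es ->
  well_formed o dirty (emit_all es).
Proof. by elim: es => //= P es IHes /andP [-> /IHes]. Qed.

Lemma well_formed_word dirty a : well_formed o dirty (emit_word a).
Proof. by apply: well_formed_all; elim: a. Qed.

Lemma well_formed_grid dirty i d (A : finType) (F : A -> emitter n W) :
  [&& i != o, ~~ dirty i & offset (d o) == 0%R] ->
  (forall a, well_formed o (fun j => [|| j == i, offset (d j) != 0%R | dirty j]) (F a)) ->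
  well_formed o dirty (emit_grid i d F).
Proof.
case/and3P=> io di d0 HF; rewrite /= io di d0 andbT /=.
by apply: well_formed_all; rewrite all_map; apply/allP => a _ /=; rewrite HF.
Qed.

Lemma emitted_grid N i d (A : finType) (F : A -> emitter n W) s v
    (E : nat -> A -> seq bool) : size (s i) = N ->
  (forall j a, j < N -> emitted o (F a) s (advance i d v j) = [seq inl c | c <- E j a]) ->
  emitted o (emit_grid i d F) s v = [seq inl c | c <- grid N E].
Proof.
move=> <- HF; rewrite /emit_grid /grid map_cat emitted_both emitted_bits.
congr (_ ++ _); rewrite emitted_for map_flatten -map_comp; congr flatten.
apply/eq_in_map => j; rewrite mem_iota => /andP [_ jN].
rewrite emitted_all [RHS]map_flatten -!map_comp; congr flatten.
by apply: eq_map => a; rewrite /comp emitted_both emitted_bits HF.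
Qed.

Lemma emitted_for_map i d (P : emitter n W) s v (F : nat -> letter) :
  (forall j, j < size (s i) -> emitted o P s (advance i d v j) = [:: F j]) ->
  emitted o (For i d P) s v = [seq F j | j <- iota 0 (size (s i))].
Proof.
move=> HP; rewrite emitted_for -[RHS]flatten_seq1 -map_comp; congr flatten.
by apply/eq_in_map => j; rewrite mem_iota => /andP [_ jN]; rewrite /comp HP.
Qed.

Lemma emitted_for_const i d (P : emitter n W) s v (w : seq letter) :
  (forall j, j < size (s i) -> emitted o P s (advance i d v j) = w) ->
  emitted o (For i d P) s v = flatten (nseq (size (s i)) w).
Proof.
move=> HP; rewrite emitted_for; congr flatten.
rewrite -[in RHS](size_iota 0 (size (s i))); move: HP.
have : all (fun j => j < size (s i)) (iota 0 (size (s i))).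
  by apply/allP => j; rewrite mem_iota => /andP [].
elim: (iota 0 _) => //= j r IHr /andP [jN rN] HP.
by rewrite HP // IHr.
Qed.

End Combinators.

(** * Writing the tableau parameters *)

(* tIO is the input and output tape, tX the copy of the input, tP the bound on the
   witness; tU and tV are scratch; tRow and tCol are the side of the tableau, tLab
   its labels and tOff the offsets of a window; tN holds the time bound, then, like
   tN', the number of cells. All numbers are in unary. *)
Definition tIO : 'I_11 := ord0.
Definition tX : 'I_11 := @Ordinal 11 1 isT.
Definition tP : 'I_11 := @Ordinal 11 2 isT.
Definition tU : 'I_11 := @Ordinal 11 3 isT.
Definition tV : 'I_11 := @Ordinal 11 4 isT.
Definition tRow : 'I_11 := @Ordinal 11 5 isT.
Definition tCol : 'I_11 := @Ordinal 11 6 isT.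
Definition tLab : 'I_11 := @Ordinal 11 7 isT.
Definition tN : 'I_11 := @Ordinal 11 8 isT.
Definition tN' : 'I_11 := @Ordinal 11 9 isT.
Definition tOff : 'I_11 := @Ordinal 11 10 isT.

Definition gadget := emitter 10 extra.
Definition store := 'I_11 -> seq (bool + extra).

Definition mark : bool + extra := inl true.

Definition copy (i : 'I_11) : gadget := For i (@still 10) (Emit (fun r => r i)).
Definition marks (i : 'I_11) : gadget := For i (@still 10) (Emit (fun=> Some mark)).

Lemma flatten_nseq_nseq (T : Type) k l (a : T) : flatten (nseq k (nseq l a)) = nseq (k * l) a.
Proof. by elim: k => //= k ->; rewrite mulSn nseqD. Qed.

Lemma emitted_marks o i (s : store) v : emitted o (marks i) s v = nseq (size (s i)) mark.
Proof. 
rewrite (emitted_for_const (w := [:: mark])) //.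
by rewrite -[[:: mark]]/(nseq 1 mark) flatten_nseq_nseq muln1.
Qed.

Lemma emitted_copy o i (s : store) v : i != o -> emitted o (copy i) s v = s i.
Proof.
move=> io; case E: (s i) => [|a r]; first by rewrite /= E.
rewrite (emitted_for_map (F := nth a (s i))) => [|j js]; last first.
  by rewrite /= /advance ffunE (negPf io) eqxx /= (nth_map a).
rewrite -E -[in iota _ _](size_map id) map_id.
apply: (@eq_from_nth _ a); rewrite size_map size_iota // => j js.
by rewrite (nth_map 0) ?size_iota // nth_iota.
Qed.

Lemma look_other n (W : finType) (o : 'I_n.+1) (s : 'I_n.+1 -> seq (bool + W)) v i :
  i != o -> look o s v i = word (s i) (v i).
Proof. by move=> io; rewrite ffunE (negPf io). Qed.

Lemma stage_same n W o (P : emitter n W) s : stage_result o P s o = emitted o P s (fun=> 0%R).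
Proof. by rewrite /stage_result eqxx. Qed.

Lemma stage_other n W o (P : emitter n W) s i : i != o -> stage_result o P s i = s i.
Proof. by rewrite /stage_result => /negPf ->. Qed.

Lemma pipe_result_cat n W (q1 q2 : seq ('I_n.+1 * emitter n W)) s :
  pipe_result (q1 ++ q2) s = pipe_result q2 (pipe_result q1 s).
Proof. by elim: q1 s => [|[o P] q1 IHq] s //=. Qed.

Lemma pipe_wf_cat n W (q1 q2 : seq ('I_n.+1 * emitter n W)) :
  pipe_wf (q1 ++ q2) = pipe_wf q1 && pipe_wf q2.
Proof. exact: all_cat. Qed.

(** Multiplies the unary number on [tU] by the length of the input. The detour through [tV] is
    forced, since a stage cannot read the tape that it writes. *)
Definition times_x : seq ('I_11 * gadget) :=
  [:: (tV, For tX (@still 10) (marks tU)); (tU, marks tV)].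

Definition poly_stages (c d : nat) (o : 'I_11) : seq ('I_11 * gadget) :=
  (tU, emit_word 10 (nseq c mark)) :: flatten (nseq d times_x) ++
  [:: (o, Both (marks tU) (emit_word 10 (nseq c mark)))].

Lemma poly_stages_wf c d o : o != tU -> pipe_wf (poly_stages c d o).
Proof.
move=> oU; rewrite /pipe_wf /poly_stages /= well_formed_word all_cat /= well_formed_word.
rewrite eq_sym oU !andbT /=; elim: d => //= d ->.
Qed.

Lemma times_x_result d (s : store) a : s tU = nseq a mark ->
  let s' := pipe_result (flatten (nseq d times_x)) s in
  s' tU = nseq (a * size (s tX) ^ d) mark /\
  (forall j, j != tU -> j != tV -> s' j = s j).
Proof.
elim: d s a => [|d IHd] s a sU; first by rewrite expn0 muln1.
have -> : flatten (nseq d.+1 times_x) = times_x ++ flatten (nseq d times_x) by [].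
rewrite pipe_result_cat; cbv zeta.
set s1 := pipe_result times_x s.
have s1j j : j != tU -> j != tV -> s1 j = s j.
  by move=> jU jV; rewrite /s1 /= stage_other // stage_other.
have s1U : s1 tU = nseq (a * size (s tX)) mark.
  rewrite /s1 /= stage_same emitted_marks stage_same.
  rewrite (emitted_for_const (w := nseq a mark)) => [|j _].
    by rewrite flatten_nseq_nseq size_nseq mulnC.
  by rewrite emitted_marks sU size_nseq.
have [-> Hj] := IHd s1 _ s1U; split; first by rewrite s1j // expnS mulnA.
by move=> j jU jV; rewrite Hj // s1j.
Qed.

Lemma poly_stages_result c d o (s : store) : 
  let s' := pipe_result (poly_stages c d o) s in
  s' o = nseq (poly_bound c d (size (s tX))) mark /\
  (forall j, j != tU -> j != tV -> j != o -> s' j = s j).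
Proof.
rewrite /= pipe_result_cat /=.
set s1 := stage_result _ _ s.
have [|s2U s2j] := @times_x_result d s1 c; first by rewrite /s1 stage_same emitted_word.
split=> [|j jU jV jo]; last by rewrite stage_other // s2j // /s1 stage_other.
rewrite stage_same emitted_both emitted_marks emitted_word s2U size_nseq.
by rewrite -nseqD /s1 stage_other.
Qed.

(** At this stage [tN] still holds the time bound. The two end letters raise the length to [side],
    so that the first and last places differ and [1 < m] always holds. *)
Definition ruler : gadget :=
  Both (emit_word 10 [:: pair_letter true false])
 (Both (For tN (@still 10) (Emit (fun=> Some (pair_letter false false))))
       (emit_word 10 [:: pair_letter false true])).

Definition offset_writer : gadget :=
  Both (emit_word 10 [:: pair_letter false false; pair_letter false true])
 (Both (marks tN) (emit_word 10 [:: pair_letter true false; pair_letter true true])).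

Definition label_letter (row col bit yes : symbol extra) : option (bool + extra) :=
  match row, col with
  | Some (inr (inr (first, last))), Some (inr (inr (head, tail))) =>
      Some (inr (inl (head, tail, first, last,
        if bit is Some (inl b) then Some b else None, yes != None)))
  | _, _ => None
  end.

(** The heads of [tX] and [tP] move along with the column, so in column [p] they show the input bit
    of that column and whether [p < P]. *)
Definition label_writer : gadget :=
  For tRow (@still 10)
    (For tCol (fun j => if (j == tX) || (j == tP) then ToRight else Stay)
       (Emit (fun r => label_letter (r tRow) (r tCol) (r tX) (r tP)))).

Definition setup (c d cB dB : nat) : seq ('I_11 * gadget) :=
  (tX, copy tIO) :: poly_stages c d tP ++ poly_stages cB dB tN ++
  [:: (tRow, ruler); (tCol, ruler); (tOff, offset_writer); (tLab, label_writer);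
      (tN, marks tLab); (tN', marks tLab)].

Lemma setup_wf c d cB dB : pipe_wf (setup c d cB dB).
Proof.
have -> : setup c d cB dB = [:: (tX, copy tIO)] ++ poly_stages c d tP ++
  poly_stages cB dB tN ++
  [:: (tRow, ruler); (tCol, ruler); (tOff, offset_writer); (tLab, label_writer);
      (tN, marks tLab); (tN', marks tLab)] by [].
by rewrite !pipe_wf_cat !poly_stages_wf.
Qed.

Lemma nth_ruler k t :
  nth None [seq Some a | a <- pair_letter true false ::
     nseq k (pair_letter false false) ++ [:: pair_letter false true]] t =
  if t < k.+2 then Some (pair_letter (t == 0) (t == k.+1)) else None.
Proof.
case: t => [//|t] /=.
rewrite map_cat map_nseq nth_cat size_nseq nth_nseq !ltnS eqSS.
case: (ltngtP t k) => [tk|kt|->] //; last by rewrite subnn.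
by rewrite nth_default //= subn_gt0.
Qed.

Lemma map_iota_pairs (T : Type) (F : nat -> nat -> T) k m : 0 < m ->
  [seq F (j %/ m) (j %% m) | j <- iota 0 (k * m)] =
  flatten [seq [seq F t p | p <- iota 0 m] | t <- iota 0 k].
Proof.
move=> m_gt0; elim: k => [|k IHk]; first by rewrite mul0n.
rewrite mulSnr iotaD map_cat IHk -[k.+1]addn1 iotaD map_cat flatten_cat /= cats0.
congr (_ ++ _); rewrite add0n -[k * m]addn0 iotaDl -map_comp.
apply/eq_in_map => p; rewrite mem_iota => /andP [_ pm] /=.
by rewrite divnMDl // modnMDl divn_small // modn_small // addn0.
Qed.

Lemma label_bit (x : seq bool) p :
  (if nth None [seq Some a | a <- [seq (inl b : bool + extra) | b <- x]] p
     is Some (inl b) then Some b else None) = nth None [seq Some b | b <- x] p :> option bool.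
Proof. by elim: x p => [|b x IHx] [|p] //=; apply: IHx. Qed.

Definition side (cB dB n : nat) : nat := (poly_bound cB dB n).+2.

Lemma setup_result c d cB dB (x : seq bool) :
  let m := side cB dB (size x) in
  let s := pipe_result (setup c d cB dB) (@input_words 10 extra x) in
  [/\ s tOff = offsets m,
      s tLab = [seq inr (inl (label_at m (poly_bound c d (size x)) x (j %/ m) (j %% m)))
                 | j <- iota 0 (m * m)],
      size (s tN) = m * m & size (s tN') = m * m].
Proof.
cbv zeta; set m := side _ _ _; set P := poly_bound c d _.
have -> : setup c d cB dB = [:: (tX, copy tIO)] ++ poly_stages c d tP ++
  poly_stages cB dB tN ++
  [:: (tRow, ruler); (tCol, ruler); (tOff, offset_writer); (tLab, label_writer);
      (tN, marks tLab); (tN', marks tLab)] by [].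
rewrite !pipe_result_cat.
set s0 := pipe_result [:: _] _.
have s0X : s0 tX = [seq inl b | b <- x].
  by rewrite /s0 /= stage_same emitted_copy // /input_words.
have [] := poly_stages_result c d tP s0.
rewrite s0X size_map -/P; set s1 := pipe_result _ s0 => s1P s1j.
have s1X : s1 tX = [seq inl b | b <- x] by rewrite s1j.
have [] := poly_stages_result cB dB tN s1.
rewrite s1X size_map; set s2 := pipe_result _ s1 => s2N s2j.
have s2X : s2 tX = [seq inl b | b <- x] by rewrite s2j.
have s2P : s2 tP = nseq P mark by rewrite s2j.
have rulerE o (s : store) : s tN = nseq (m - 2) mark ->
    emitted o ruler s (fun=> 0%R) = pair_letter true false ::
     nseq (m - 2) (pair_letter false false) ++ [:: pair_letter false true].
  move=> sN; rewrite /ruler emitted_both emitted_word emitted_both emitted_word.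
  rewrite (emitted_for_const (w := nseq 1 (pair_letter false false))) //.
  by rewrite flatten_nseq_nseq muln1 sN size_nseq.
have mE : m - 2 = poly_bound cB dB (size x) by rewrite /m /side !subSS subn0.
rewrite -mE in s2N.
rewrite /=.
set s3 := stage_result tRow _ s2; set s4 := stage_result tCol _ s3.
set s5 := stage_result tOff _ s4; set s6 := stage_result tLab _ s5.
have s3N : s3 tN = nseq (m - 2) mark by rewrite /s3 stage_other.
have s4N : s4 tN = nseq (m - 2) mark by rewrite /s4 stage_other.
have labE : s6 tLab = [seq inr (inl (label_at m P x (j %/ m) (j %% m))) | j <- iota 0 (m * m)].
  rewrite /s6 stage_same /label_writer.
  have s5X : s5 tX = [seq inl b | b <- x] by rewrite /s5 !stage_other.
  have s5P : s5 tP = nseq P mark by rewrite /s5 !stage_other.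
  have s5R : s5 tRow = pair_letter true false ::
     nseq (m - 2) (pair_letter false false) ++ [:: pair_letter false true].
    by rewrite /s5 /s4 2?stage_other // /s3 stage_same rulerE.
  have s5C : s5 tCol = pair_letter true false ::
     nseq (m - 2) (pair_letter false false) ++ [:: pair_letter false true].
    by rewrite /s5 stage_other // /s4 stage_same rulerE.
  have rsize : size (pair_letter true false ::
     nseq (m - 2) (pair_letter false false) ++ [:: pair_letter false true]) = m.
    by rewrite /= size_cat size_nseq /m /side /=; lia.
  have m_gt0 : 0 < m by [].
  rewrite (map_iota_pairs (fun t p => inr (inl (label_at m P x t p)))) //.
  rewrite emitted_for s5R rsize; congr flatten.
  apply/eq_in_map => t; rewrite mem_iota => /andP [_ tm].
  rewrite (emitted_for_map (F := fun p => inr (inl (label_at m P x t p)))).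
    by rewrite s5C rsize.
  rewrite s5C rsize => p pm.
  set v := advance _ _ _ _.
  have vRow : v tRow = Posz t by rewrite /v /advance /=; lia.
  have vCol : v tCol = Posz p by [].
  have vX : v tX = Posz p by rewrite /v /advance /=; lia.
  have vP : v tP = Posz p by rewrite /v /advance /=; lia.
  rewrite /emitted !look_other // vRow vCol vX vP s5R s5C s5X s5P /word.
  have mS : m - 2 = m.-2 by lia.
  rewrite !nth_ruler mS (_ : m.-2.+2 = m) // tm pm /=.
  by rewrite label_bit map_nseq nth_nseq /label_at; case: (p < P).
have offE : s6 tOff = offsets m.
  rewrite /s6 stage_other // /s5 stage_same /offset_writer emitted_both emitted_word.
  by rewrite emitted_both emitted_marks emitted_word s4N size_nseq.
split.
- by rewrite !stage_other.
- by rewrite !stage_other.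
- by rewrite stage_other // stage_same emitted_marks labE size_nseq size_map size_iota.
- rewrite stage_same emitted_marks size_nseq stage_other //.
  by rewrite labE size_map size_iota.
Qed.

(** * Writing the instance *)

Section Reduction.

Variable M : machine.

Definition some_colour : colour M :=
  ((false, false, false, false, None, false), start M,
   [ffun=> None], [ffun=> None], [ffun=> None], None).

Definition entry_read (d : demand M) (g : colour M) (s s' : symbol extra) : bool :=
  if s is Some (inr (inl l)) then entry_bit d g l s' else false.

(** The outer loop, over worker cells [j'], moves [tOff] to the right and the inner one, over domain
    cells [j], moves it to the left. Its head thus stands at [j' - j], so the difference needs no
    arithmetic. *)
Definition skill_writer : gadget :=
  emit_grid tLab (@moving 10 tOff ToRight) (fun g : colour M =>
    emit_grid tN (@moving 10 tOff ToLeft) (fun d : demand M =>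
      Both (emit_bits 10 extra [:: false; true])
     (Both (Emit (fun r => Some (inl (entry_read d g (r tLab) (r tOff)))))
           (emit_bits 10 extra [:: false; true; true; false])))).

(** In the inner round [j] the head of [tN'] is at [j' - j], which is nonblank exactly when
    [j <= j']. So the digit zero is printed [j' + 1] times, as the denominator [2 ^ (j' + 1)]
    requires. *)
Definition wage_writer : gadget :=
  emit_grid tN (@moving 10 tN' ToRight) (fun _ : colour M =>
    Both (emit_bits 10 extra [:: false; true; true; false])
   (Both (For tLab (@moving 10 tN' ToLeft)
           (Both (Emit (fun r => if r tN' is Some _ then Some (inl true) else None))
                 (Emit (fun r => if r tN' is Some _ then Some (inl false) else None))))
         (emit_bits 10 extra [:: true; true; false]))).

Definition dist_writer : gadget :=
  emit_grid tLab (@still 10) (fun _ : colour M =>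
    emit_grid tN (@still 10) (fun _ : colour M => emit_bits 10 extra (enc_rat 0))).

Definition threshold_writer : gadget :=
  emit_grid tN (@still 10) (fun _ : demand M => emit_bits 10 extra (enc_rat 1)).

Definition repeat_bits (b : seq bool) : gadget := For tN (@still 10) (emit_bits 10 extra b).

Definition instance_writer (suffix : seq bool) : gadget :=
  emit_all [:: skill_writer; wage_writer; dist_writer; threshold_writer;
    emit_bits 10 extra [:: false]; repeat_bits [:: true; true];
    emit_bits 10 extra [:: false]; repeat_bits [:: true; false];
    emit_bits 10 extra ([:: true; true; false] ++ suffix)].

Lemma instance_writer_wf suffix : well_formed tIO (fun=> false) (instance_writer suffix).
Proof.
apply: well_formed_all; apply/and5P; split.
- by apply: well_formed_grid => // g; apply: well_formed_grid.
- by apply: well_formed_grid.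
- by apply: well_formed_grid => // g; apply: well_formed_grid.
- exact: well_formed_grid.
- by rewrite /= !well_formed_word.
Qed.

Lemma flatten_initial (T : Type) (w : seq T) k N : k < N ->
  flatten [seq if j <= k then w else [::] | j <- iota 0 N] = flatten (nseq k.+1 w).
Proof.
move=> kN; rewrite -(subnKC kN) iotaD map_cat flatten_cat.
have -> : [seq if j <= k then w else [::] | j <- iota 0 k.+1] = [seq w | _ <- iota 0 k.+1].
  by apply/eq_in_map => j; rewrite mem_iota add0n ltnS => /andP [_ ->].
have -> : [seq if j <= k then w else [::] | j <- iota (0 + k.+1) (N - k.+1)] =
          [seq [::] | _ <- iota (0 + k.+1) (N - k.+1)].
  by apply/eq_in_map => j; rewrite mem_iota => /andP [kj _]; rewrite leqNgt kj.
have const (a : seq T) i l : [seq a | _ <- iota i l] = nseq l a.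
  by elim: l i => //= l IHl i; rewrite IHl.
by rewrite !const; elim: (N - _) => [|l /= ->]; rewrite ?cats0.
Qed.

Variables (m P : nat) (x : seq bool).
Hypothesis m_gt1 : 1 < m.

Definition cell_instance : grp_data :=
  cover_data some_colour (None : demand M) (m * m) (covers m P x).

Lemma instance_writerE suffix (s : store) :
  s tOff = offsets m ->
  s tLab = [seq inr (inl (label_at m P x (j %/ m) (j %% m))) | j <- iota 0 (m * m)] ->
  size (s tN) = m * m -> size (s tN') = m * m ->
  emitted tIO (instance_writer suffix) s (fun=> 0%R) =
  [seq inl b | b <- enc_grp cell_instance ++ suffix].
Proof.
move=> sOff sLab sN sN'.
have labsize : size (s tLab) = m * m by rewrite sLab size_map size_iota.
rewrite enc_cover; last by rewrite muln_gt0; lia.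
have skillE : emitted tIO skill_writer s (fun=> 0%R) = [seq inl b | b <-
   grid (m * m) (fun j' (g : colour M) => grid (m * m) (fun j (d : demand M) =>
          [:: false; true; covers m P x j' g j d; false; true; true; false]))].
  apply: emitted_grid => // j' g j'N; apply: emitted_grid => // j d jN.
  rewrite emitted_both emitted_bits emitted_both emitted_bits.
  set v := advance _ _ _ _.
  have vLab : v tLab = Posz j' by rewrite /v /advance /=; lia.
  have vOff : v tOff = (j'%:Z - j%:Z)%R by rewrite /v /advance /=; lia.
  rewrite /emitted !look_other // vLab vOff sOff /=.
  rewrite sLab -map_comp (nth_map 0) ?size_iota // nth_iota //.
have wageE : emitted tIO wage_writer s (fun=> 0%R) = [seq inl b | b <-
    grid (m * m) (fun j' (_ : colour M) => [:: false; true; true; false] ++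
          flatten (nseq j'.+1 [:: true; false]) ++ [:: true; true; false])].
  apply: emitted_grid => // j' g j'N.
  rewrite emitted_both emitted_bits emitted_both emitted_bits
    map_cat (map_cat _ (flatten _)).
  congr (_ ++ (_ ++ _)).
  rewrite map_flatten map_nseq -(flatten_initial _ j'N) emitted_for labsize.
  congr flatten; apply/eq_in_map => j; rewrite mem_iota => /andP [_ jN].
  rewrite emitted_both /emitted !look_other //.
  set z := advance _ _ _ _ _.
  have -> : z = (j'%:Z - j%:Z)%R by rewrite /z /advance /=; lia.
  have -> : (j <= j') = (word (s tN') (j'%:Z - j%:Z)%R != None).
    by rewrite word_eqNone negbK sN'; lia.
  by case: (word _ _).
have distE : emitted tIO dist_writer s (fun=> 0%R) = [seq inl b | b <-
    grid (m * m) (fun _ (_ : colour M) => grid (m * m) (fun _ (_ : colour M) => enc_rat 0))].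
  by apply: emitted_grid => // j' g j'N; apply: emitted_grid.
have thrE : emitted tIO threshold_writer s (fun=> 0%R) = [seq inl b | b <-
    grid (m * m) (fun _ (_ : demand M) => enc_rat 1)].
  by apply: emitted_grid.
have repE b : emitted tIO (repeat_bits b) s (fun=> 0%R) =
    [seq inl c | c <- flatten (nseq (m * m) b)].
  rewrite (emitted_for_const (w := [seq inl c | c <- b])) => [|j _]; last exact: emitted_bits.
  by rewrite sN map_flatten map_nseq.
have catE (w1 w2 w3 w4 w5 w6 : seq bool) :
    (w1 ++ w2 ++ w3 ++ w4 ++ false :: w5 ++ [:: false] ++
       w6 ++ [:: true; true; false]) ++ suffix =
    w1 ++ w2 ++ w3 ++ w4 ++ [:: false] ++ w5 ++ [:: false] ++
      w6 ++ [:: true; true; false] ++ suffix.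
  by rewrite -!catA /= -!catA /= -!catA.
have allE (p1 p2 p3 p4 p5 p6 p7 p8 p9 : gadget) v (e := fun p => emitted tIO p s v) :
  e (emit_all [:: p1; p2; p3; p4; p5; p6; p7; p8; p9]) =
  e p1 ++ e p2 ++ e p3 ++ e p4 ++ e p5 ++ e p6 ++ e p7 ++ e p8 ++ e p9.
  by rewrite /e emitted_all /= cats0.
rewrite catE /instance_writer allE skillE wageE distE thrE !repE !emitted_bits.
by rewrite -!map_cat.
Qed.

End Reduction.

(** * Assembling the reduction *)

Lemma poly_bound_mono c d a b : a <= b -> poly_bound c d a <= poly_bound c d b.
Proof.
move=> ab; rewrite leq_add2r leq_mul //.
by case: d => // d; rewrite leq_exp2r.
Qed.

Definition reduction (M : machine) (c d cB dB : nat) (suffix : seq bool) :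
    seq ('I_11 * gadget) :=
  setup c d cB dB ++ [:: (tIO, instance_writer M suffix)].

Definition reduced (M : machine) (c d cB dB : nat) (x : seq bool) : grp_data :=
  cell_instance M (side cB dB (size x)) (poly_bound c d (size x)) x.

Lemma reduction_wf M c d cB dB suffix : pipe_wf (reduction M c d cB dB suffix).
Proof.
have w : well_formed tIO (fun=> false) (instance_writer M suffix) && true.
  by rewrite instance_writer_wf.
by rewrite pipe_wf_cat setup_wf; exact: w.
Qed.

Lemma reduction_result M c d cB dB suffix x :
  pipe_result (reduction M c d cB dB suffix) (@input_words 10 extra x) ord0 =
  [seq inl b | b <- enc_grp (reduced M c d cB dB x) ++ suffix].
Proof.
have [sOff sLab sN sN'] := setup_result c d cB dB x.
rewrite pipe_result_cat.
have -> s : pipe_result [:: (tIO, instance_writer M suffix)] s =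
  stage_result tIO (instance_writer M suffix) s by [].
by rewrite stage_same; apply: instance_writerE.
Qed.

Lemma NP_reduced (L : language) : NP L -> exists M c d cB dB, forall x,
  (exists G : {set 'I_(workers (reduced M c d cB dB x))}, feasible G) <-> L x.
Proof.
case=> V [M [cV [dV VM]]] [c [d Ld]].
(* The side of the tableau may depend on the input only, so the verifier's running time is bounded
   over all witnesses of admissible length. *)
have [cB [dB bound]] : exists cB dB, forall n,
    poly_bound cV dV (n + poly_bound c d n) <= poly_bound cB dB n.
  apply: (poly_boundedP (g := fun n => poly_bound cV dV (n + poly_bound c d n))).
  apply: (@poly_bounded_comp (poly_bound cV dV) (fun n => n + poly_bound c d n)).
    exact: poly_bounded_poly_bound.
  by apply: poly_bounded_add; [exact: poly_bounded_id|exact: poly_bounded_poly_bound].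
exists M, c, d, cB, dB => x; set m := side cB dB (size x); set P := poly_bound c d (size x).
have m_gt1 : 1 < m by [].
(* A halted configuration is a fixed point of [step], so the verdict can be read in row [m.-1],
   after the time bound. *)
have acc y : size y <= P -> accepting (cstate (@run M x y m.-1)) = V x y.
  move=> yP; have [halt <-] := VM x y.
  have le : poly_bound cV dV (size x + size y) <= m.-1.
    apply: leq_trans (leqW (bound _)).
    by apply: poly_bound_mono; rewrite leq_add2l.
  by rewrite /run -(subnK le) iterD iter_fix // /step halt.
have own : forall j' (g : colour M) j, j < m * m -> covers m P x j' g j None -> j' = j :> nat.
  by move=> j' g j _; exact: covers_None.
have [to_col of_col] := cover_feasible (some_colour M) None own.
have [to_cov of_cov] := tableau_covers M P x m_gt1.
split=> [/to_col/of_cov [col /(tableau_run m_gt1) [y yP]]|].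
  by rewrite acc // => Vxy; apply/Ld; exists y.
case/Ld=> y [yP Vxy]; apply/of_col/to_cov.
by exists (@true_colour M m P x y); apply: run_tableau; rewrite ?acc.
Qed.

Lemma optimal_reduced M c d cB dB x (G : {set 'I_(workers (reduced M c d cB dB x))}) :
  feasible G -> optimal G.
Proof. by move=> fG; split=> // H _; rewrite /reduced !diameter_cover. Qed.

Theorem theorem2 : NP_hard_search Grp_optimization /\ NP_hard Grp_decision.
Proof.
split=> L /NP_reduced [M [c [d [cB [dB HL]]]]].
- apply: (pipe_poly_turing (reduction_wf M c d cB dB [::])
            (reduction_result M c d cB dB [::])) => O HO x.
  rewrite cats0 -HL; set J := reduced M c d cB dB x in HL *.
  have J_ok : grp_instance J by exact: cover_instance.
  have [|I [_ /esym eqI sol]] := HO (enc_grp J).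
    (* A solver is only bound on instances that have an answer. One exists in either case: a
       feasible group, which is then optimal, or the bit for infeasibility. *)
    have [[G fG]|none] := classic (exists G : {set 'I_(workers J)}, feasible G).
      exists (true :: [seq u \in G | u <- enum 'I_(workers J)]), J; split=> //.
      by left; exists G => //; exact: optimal_reduced.
    exists [:: false], J; split=> //; right; split=> // G fG.
    by apply: none; exists G.
  (* The answer is certified for some instance with the same code; decoding identifies it with
     [J]. *)
  have [eIJ _] : I = J /\ [::] = [::] :> seq bool.
    by apply: enc_grp_injective; rewrite !cats0.
  subst I; case: sol => [[G [fG _] ->]|[none ->]]; first by split=> // _; exists G.
  by split=> // -[G /none].
- exists (fun x => enc_grp (reduced M c d cB dB x) ++ enc_rat 0).
    exact: pipe_polytime (reduction_wf M c d cB dB (enc_rat 0))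
             (reduction_result M c d cB dB (enc_rat 0)).
  move=> x; rewrite -HL; split=> [[G fG]|[I [X [_ /esym eqI [G [fG _]]]]]].
    exists (reduced M c d cB dB x), 0%R; split=> //; first exact: cover_instance.
    by exists G; split=> //; rewrite /reduced diameter_cover.
  have [eI _] := enc_grp_injective eqI.
  by subst I; exists G.
Qed.
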